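(* There exist numerical constants $C>0$ (sufficiently large) and $c>0$ such that the following holds. Let $\mathbf A$ be the $N\times N$ adjacency matrix of a graph under the generalized stochastic block model (GSBM) with $n$ inliers, $m$ outliers, $r$ communities of sizes $l_1,\dots,l_r$, connectivity matrix $\mathbf B$, unknown permutation matrix $\mathbf P$, and parameters $p^-,q^+,\delta=p^--q^+>0,n_{\min}$ (see context). Let $\alpha,\lambda$ be real tuning parameters and let $\widehat{\mathbf X}$ be a solution to the semidefinite program $$\min_{\widetilde{\mathbf X}}\ \langle \widetilde{\mathbf X},\mathbf E\rangle\quad\text{subject to}\quad \widetilde{\mathbf X}\succeq \mathbf 0,\quad 0\le \widetilde X_{ij}\le 1\ \ (1\le i,j\le N),$$ where $\mathbf E=\alpha\mathbf I_N-(1-\lambda)\mathbf A+\lambda(\mathbf J_N-\mathbf I_N-\mathbf A)$. Suppose that $p^-\ge C\frac{\log n}{n_{\min}}$, $\alpha\ge 3m$, $$\delta>C\left(\sqrt{\frac{p^-\log n}{n_{\min}}}+\frac{\alpha}{n_{\min}}+\frac{\sqrt{nq^+\log n}}{n_{\min}}+\frac{m\sqrt r}{n_{\min}}+\frac{nmp^-}{(\alpha-2m)n_{\min}}\right),$$ and $$q^++\frac{\delta}{4}<\lambda<p^--\frac{\delta}{4}.$$ Then with probability at least $1-\frac1n-\frac{2r}{n^2}-\frac{cr}{n_{\min}^4}$, $\widehat{\mathbf X}$ must be of the form $$\widehat{\mathbf X}=\mathbf P\begin{bmatrix}\mathbf J_{l_1}& & &\widehat{\mathbf Z}_1\\ &\ddots&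 &\vdots\\ & &\mathbf J_{l_r}&\widehat{\mathbf Z}_r\\ \widehat{\mathbf Z}_1^{\top}&\cdots&\widehat{\mathbf Z}_r^{\top}&\widehat{\mathbf W}\end{bmatrix}\mathbf P^{\top}$$ for some matrices $\widehat{\mathbf Z}_i\in\mathbb R^{l_i\times m}$ and $\widehat{\mathbf W}\in\mathbb R^{m\times m}$, where the off-diagonal blocks among the first $r$ block rows and columns are zero.
   Context: Notation: $\mathbf I_\ell$ is the $\ell\times\ell$ identity, $\mathbf J_\ell$ the $\ell\times\ell$ all-ones matrix, $\langle\mathbf M_1,\mathbf M_2\rangle$ the trace inner product, $\mathbf M\succeq\mathbf 0$ means symmetric positive semidefinite. GSBM: $N=n+m$ nodes, of which $n$ are inliers and $m$ are outliers. The inliers are divided into $r\ge2$ communities of sizes $l_1,\dots,l_r\ge1$, $n=\sum_{i=1}^r l_i$. The adjacency matrix is $$\mathbf A=\mathbf P\begin{bmatrix}\mathbf K&\mathbf Z\\ \mathbf Z^\top&\mathbf W\end{bmatrix}\mathbf P^\top,$$ where $\mathbf P$ is an unknown fixed $N\times N$ permutation matrix; $\mathbf K$ is a random symmetric $n\times n$ $0$-$1$ matrix with zero diagonal, partitioned into blocks $\mathbf K_{ij}$ of size $l_i\times l_j$, whose entries strictly above the diagonal are independent Bernoulli variables, with parameter $B_{ij}$ for an entry lying in block $\mathbf K_{ij}$; $\mathbf B=(B_{ij})$ is a symmetric $r\times r$ matrix with entries in $[0,1]$; $\mathbf Z$ is an arbitrary $n\times m$ $0$-$1$ matrix and $\mathbf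 W$ an arbitrary symmetric $m\times m$ $0$-$1$ matrix with zero diagonal. $\mathbf Z$ and $\mathbf W$ are allowed to be random and to depend on $\mathbf K$ in an arbitrary way. Parameters: $p^-=\min_{1\le i\le r}B_{ii}$, $q^+=\max_{1\le i<j\le r}B_{ij}$, $\delta=p^--q^+$ (assumed $>0$), $n_{\min}=\min_{1\le i\le r}l_i$. When $m=0$, the term $\frac{nmp^-}{(\alpha-2m)n_{\min}}$ is read as $0$ (even if $\alpha=0$). *)

(* Defs.v *)
From HB Require Import structures.
From mathcomp Require Import all_boot all_order all_algebra.
From mathcomp Require Import all_classical all_reals all_analysis.

Set Implicit Arguments.
Unset Strict Implicit.
Unset Printing Implicit Defensive.

Import Order.TTheory GRing.Theory Num.Theory.
Local Open Scope classical_set_scope.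
Local Open Scope ring_scope.

Definition random_mx (R : realType) (d : measure_display) (T : measurableType d)
    (a b : nat) (M : T -> 'M[R]_(a, b)) : Prop :=
  forall i j, measurable_fun [set: T] (fun w => M w i j).

Definition zero_one_mx (R : realType) (a b : nat) (M : 'M[R]_(a, b)) : Prop :=
  forall i j, M i j = 0 \/ M i j = 1.

Definition adjacency_mx (R : realType) (a : nat) (M : 'M[R]_a) : Prop :=
  [/\ zero_one_mx M, M^T = M & forall i, M i i = 0].

(* Mutual independence of the family (X i), i in D. *)
Definition mutually_independent (R : realType) (d : measure_display)
    (T : measurableType d) (Pr : probability T R) (I : finType) (D : {set I})
    (X : I -> T -> R) : Prop :=
  forall J : {set I}, J \subset D ->
  forall U : I -> set R, (forall i, measurable (U i)) ->
  Pr (\bigcap_(i in [set i | i \in J]) (X i @^-1` U i)) =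
  (\prod_(i in J) Pr (X i @^-1` U i))%E.

(* The l i are the community sizes; inlier a : 'I_(\sum_i l i) lies in community
   tagnat.sig1 a, the communities being numbered consecutively exactly as the
   blocks of \mxblock and \mxdiag. *)
Record GSBM (R : realType) (d : measure_display) (T : measurableType d)
    (Pr : probability T R) (r m : nat) (l : 'I_r -> nat) (B : 'M[R]_r)
    (P : 'M[R]_(\sum_i l i + m)) (K : T -> 'M[R]_(\sum_i l i))
    (Z : T -> 'M[R]_(\sum_i l i, m)) (W : T -> 'M[R]_m)
    (A : T -> 'M[R]_(\sum_i l i + m)) : Prop := {
  gsbm_size_gt0 : forall i, (0 < l i)%N ;
  gsbm_B_sym : B^T = B ;
  gsbm_B_01 : forall i j, 0 <= B i j <= 1 ;
  gsbm_P_perm : is_perm_mx P ;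
  gsbm_K_random : random_mx K ;
  gsbm_K_adj : forall w, adjacency_mx (K w) ;
  gsbm_K_indep : mutually_independent Pr
    [set ab : 'I_(\sum_i l i) * 'I_(\sum_i l i) | (ab.1 < ab.2)%N]%SET
    (fun ab w => K w ab.1 ab.2) ;
  gsbm_K_bernoulli : forall a b : 'I_(\sum_i l i), (a < b)%N ->
    Pr [set w | K w a b = 1] = (B (tagnat.sig1 a) (tagnat.sig1 b))%:E ;
  gsbm_Z_random : random_mx Z ;
  gsbm_Z_01 : forall w, zero_one_mx (Z w) ;
  gsbm_W_random : random_mx W ;
  gsbm_W_adj : forall w, adjacency_mx (W w) ;
  gsbm_A : forall w, A w = P *m block_mx (K w) (Z w) (Z w)^T (W w) *m P^T
}.

(* The default values of the iterated min and max below are harmless: the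
   entries of B lie in [0, 1], r >= 2, and l i <= \sum_j l j. *)
Definition p_minus (R : realType) (r : nat) (B : 'M[R]_r) : R :=
  \big[Num.min/1]_(i < r) B i i.

Definition q_plus (R : realType) (r : nat) (B : 'M[R]_r) : R :=
  \big[Num.max/0]_(ij : 'I_r * 'I_r | (ij.1 < ij.2)%N) B ij.1 ij.2.

Definition gap (R : realType) (r : nat) (B : 'M[R]_r) : R :=
  p_minus B - q_plus B.

Definition n_min (r : nat) (l : 'I_r -> nat) : nat :=
  \big[minn/(\sum_i l i)%N]_(i < r) l i.

Definition psd (R : realType) (N : nat) (X : 'M[R]_N) : Prop :=
  X^T = X /\ forall v : 'cV[R]_N, 0 <= (v^T *m X *m v) 0 0.

Definition trace_inner (R : realType) (N : nat) (X Y : 'M[R]_N) : R :=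
  \tr (X^T *m Y).

Definition sdp_cost (R : realType) (N : nat) (alpha lambda : R) (A : 'M[R]_N) :
    'M[R]_N :=
  alpha%:M - (1 - lambda) *: A + lambda *: (const_mx 1 - 1%:M - A).

Definition sdp_feasible (R : realType) (N : nat) (X : 'M[R]_N) : Prop :=
  psd X /\ forall i j, 0 <= X i j <= 1.

Definition sdp_solution (R : realType) (N : nat) (alpha lambda : R)
    (A X : 'M[R]_N) : Prop :=
  sdp_feasible X /\
  forall Y : 'M[R]_N, sdp_feasible Y ->
    trace_inner X (sdp_cost alpha lambda A) <=
    trace_inner Y (sdp_cost alpha lambda A).

Definition recovery_form (R : realType) (r m : nat) (l : 'I_r -> nat)
    (P X : 'M[R]_(\sum_i l i + m)) : Prop :=
  exists (Zh : forall i : 'I_r, 'M[R]_(l i, m)) (Wh : 'M[R]_m),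
    X = P *m block_mx (\mxdiag_(i < r) (const_mx 1 : 'M[R]_(l i)))
                      (\mxcol_(i < r) Zh i)
                      (\mxrow_(i < r) (Zh i)^T)
                      Wh *m P^T.

(* Main.v *)
Require Import Defs.
From mathcomp Require Import fingroup perm.
From mathcomp Require Import all_boot all_order all_algebra.
From mathcomp Require Import all_classical all_reals all_analysis.
From mathcomp Require Import ring lra zify.

(**
A feasible [X] is compared with the feasible matrix whose inlier block is the
block-diagonal matrix of ones and whose outlier part is [1 z^T] and
[sum_i z_i z_i^T], where [z] minimizes the outlier cost over
[z_i(b) >= 0, sum_i z_i(b)^2 <= 1]. Write [X] as the Gram matrix of vectors [x_a]
(inliers) and [w_b] (outliers), let [u_i] be the centroid of community [i], and
expand [w_b = sum_i z_i(b) u_i + y_b]. The optimality conditions for [z] cancel the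
terms linear in [y], and what remains is controlled by the multipliers [nu_b] of
the constraints [sum_i z_i(b)^2 <= 1]: an outlier with many edges has a large
[nu_b]. Hence the outliers cost at most
[O(m sqrt r + n m p / (alpha - 2 m)) / nmin] times the defect
[sum_(a ~ b) (1 - X_ab) + sum_(a !~ b) X_ab], whereas the inliers gain a multiple
of [delta] times the defect, provided that the row sums and the largest eigenvalues
of the centred adjacency matrix, restricted to one community or to pairs of
distinct communities, are small.

These deviations have probability at most [1 / n] by the moment method with
exponent [L ~ log n]: the expectation of a product of centred edge variables along
a word vanishes unless every edge occurs at least twice, so giving an old edge the
weight [x >= 1] and a new edge [e] the weight [v_e / x] bounds the [L]-th moment by
a product over the letters. The loss of a logarithmic factor is harmless here.
Since the graph takes finitely many values, the estimates take place on the finite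
product space of edge configurations.
*)

Set Implicit Arguments.
Unset Strict Implicit.
Unset Printing Implicit Defensive.

Import Order.TTheory GRing.Theory Num.Theory.
Import numFieldNormedType.Exports.
Local Open Scope classical_set_scope.
Local Open Scope ring_scope.

(** * Products of Bernoulli variables *)

Section BernoulliProduct.
Context {R : realFieldType} {I : finType}.
Variable pr : I -> R.
Hypothesis pr01 : forall e, 0 <= pr e <= 1.

Definition bern_weight (k : {ffun I -> bool}) : R :=
  \prod_e (if k e then pr e else 1 - pr e).

Definition bern_expect (f : {ffun I -> bool} -> R) : R :=
  \sum_k bern_weight k * f k.

Lemma bern_weight_ge0 k : 0 <= bern_weight k.
Proof.
apply: prodr_ge0 => e _; have /andP[p0 p1] := pr01 e.
by case: (k e) => //; rewrite subr_ge0.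
Qed.

Lemma bern_expect_prod (h : I -> bool -> R) :
  bern_expect (fun k => \prod_e h e (k e)) =
  \prod_e (pr e * h e true + (1 - pr e) * h e false).
Proof.
under [RHS]eq_bigr => e _.
  rewrite -(big_bool _ (fun b : bool => (if b then pr e else 1 - pr e) * h e b)).
  over.
rewrite bigA_distr_bigA; apply: eq_bigr => k _.
by rewrite -big_split.
Qed.

Lemma bern_expect1 : bern_expect (fun=> 1) = 1.
Proof.
transitivity (bern_expect (fun k => \prod_(e : I) 1)).
  by apply: eq_bigr => k _; rewrite big1.
by rewrite (bern_expect_prod (fun _ _ => 1)) big1 // => e _; rewrite !mulr1 addrC subrK.
Qed.

Lemma eq_bern_expect f g : f =1 g -> bern_expect f = bern_expect g.
Proof. by move=> fg; apply: eq_bigr => k _; rewrite fg. Qed.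

Lemma bern_expectZ c f : bern_expect (fun k => c * f k) = c * bern_expect f.
Proof. by rewrite /bern_expect mulr_sumr; apply: eq_bigr => k _; rewrite mulrCA. Qed.

Lemma bern_expect_sum (T : finType) (f : T -> {ffun I -> bool} -> R) :
  bern_expect (fun k => \sum_t f t k) = \sum_t bern_expect (f t).
Proof.
rewrite /bern_expect exchange_big; apply: eq_bigr => k _.
by rewrite mulr_sumr.
Qed.

Lemma bern_markov (f : {ffun I -> bool} -> R) (A : pred {ffun I -> bool}) s t :
    (forall k, 0 <= f k) -> (forall k, A k -> s <= f k) -> 0 < s ->
  bern_expect f <= t * s -> \sum_(k | A k) bern_weight k <= t.
Proof.
move=> f0 Af s0 Ef; rewrite -(ler_pM2r s0); apply: le_trans Ef.
rewrite mulr_suml /bern_expect [leRHS](bigID A) /=.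
rewrite -[leLHS]addr0 lerD ?sumr_ge0// => [|k _].
  by apply: ler_sum => k /Af; apply: ler_wpM2l; exact: bern_weight_ge0.
by rewrite mulr_ge0 ?bern_weight_ge0.
Qed.

Definition bern_noise (k : {ffun I -> bool}) (e : I) : R := (k e)%:R - pr e.

(* This bounds [E (prod xi_e ^+ c)] by [x ^+ c * v_e / x ^+ 2] for one edge of
   multiplicity [c]: the factor vanishes for [c = 1]. *)
Lemma bern_noise_moment (p x : R) (c : nat) : 0 <= p <= 1 -> 1 <= x ->
  `|p * (1 - p) ^+ c + (1 - p) * (0 - p) ^+ c| <=
  (if c == 0%N then 1 else x ^+ c * (p / x ^+ 2)).
Proof.
move=> /andP[p0 p1] x1; have x0 : 0 < x by exact: lt_le_trans ltr01 x1.
have q0 : 0 <= 1 - p by rewrite subr_ge0.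
have q1 : 1 - p <= 1 by rewrite gerBl.
case: c => [|[|c]] /=.
- by rewrite !expr0 !mulr1 addrC subrK normr1.
- rewrite !expr1; have -> : p * (1 - p) + (1 - p) * (0 - p) = 0 by ring.
  by rewrite normr0 mulr_ge0 ?divr_ge0 ?exprn_ge0 // ltW.
have -> : x ^+ c.+2 * (p / x ^+ 2) = x ^+ c * p.
  rewrite mulrCA mulrC; congr (_ * _).
  by rewrite -addn2 exprD mulfK // expf_neq0 // gt_eqF.
apply: (@le_trans _ _ p); last by rewrite ler_peMl // exprn_ege1.
have qc : p * (1 - p) ^+ c.+2 <= p * (1 - p).
  by rewrite ler_wpM2l // exprSr ler_piMl // exprn_ile1.
have pc : (1 - p) * p ^+ c.+2 <= p * p.
  rewrite exprSr mulrA [leRHS]mulrC ler_wpM2r //.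
  by rewrite exprSr mulrA ler_piMl // mulr_ile1 ?exprn_ge0 ?exprn_ile1.
apply: (le_trans (ler_normD _ _));
  rewrite sub0r (normrM p) (normrM (1 - p) ((- p) ^+ _)) !normrX normrN !ger0_norm //.
by rewrite (le_trans (lerD qc pc)) // -mulrDr subrK mulr1.
Qed.

Lemma prodr_count (F : I -> R) (es : seq I) :
  \prod_(e <- es) F e = \prod_e F e ^+ count_mem e es.
Proof.
elim: es => [|e es IH]; first by rewrite big_nil big1.
rewrite big_cons IH [RHS](bigD1 e) //= [in LHS](bigD1 e) //= eqxx exprD expr1 mulrA.
by congr (_ * _); apply: eq_bigr => i /negPf; rewrite eq_sym => ->.
Qed.

(** The first occurrence of an edge [e] contributes [pr e / x], each further occurrence [x]. *)
Definition edge_weight (x : R) (es : seq I) : R :=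
  x ^+ size es * \prod_(e <- undup es) (pr e / x ^+ 2).

Lemma edge_weight_ge0 x es : 0 <= x -> 0 <= edge_weight x es.
Proof.
move=> x0; rewrite mulr_ge0 ?exprn_ge0 //; apply: prodr_ge0 => e _.
by rewrite divr_ge0 ?exprn_ge0 //; case/andP: (pr01 e).
Qed.

Lemma edge_weight_cons x e es :
  edge_weight x (e :: es) =
  x * (if e \in es then 1 else pr e / x ^+ 2) * edge_weight x es.
Proof.
rewrite /edge_weight /= exprS -!mulrA; congr (_ * _).
case: ifP => _; first by rewrite mul1r.
by rewrite big_cons mulrCA.
Qed.

(** Grouping equal letters gives a product over edges, whose expectation factors by
    [bern_expect_prod]; [bern_noise_moment] bounds each factor. *)
Lemma bern_expect_noise_prod x es : 1 <= x ->
  `|bern_expect (fun k => \prod_(e <- es) bern_noise k e)| <= edge_weight x es.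
Proof.
move=> x1.
pose h e (b : bool) := (b%:R - pr e) ^+ count_mem e es.
rewrite (@eq_bern_expect _ (fun k => \prod_e h e (k e))); last first.
  by move=> k; rewrite prodr_count.
rewrite (bern_expect_prod h) normr_prod.
have -> : edge_weight x es = \prod_e (if count_mem e es == 0%N then 1
    else x ^+ count_mem e es * (pr e / x ^+ 2)).
  rewrite /edge_weight (_ : x ^+ size es = \prod_(e <- es) x); last first.
    by rewrite big_const_seq count_predT iter_mulr_1.
  rewrite prodr_count (big_uniq _ (undup_uniq es)) [X in _ * X]big_mkcond /= -big_split /=.
  apply: eq_bigr => e _; rewrite mem_undup.
  case: ifPn => [|/count_memPn ->]; last by rewrite expr0 mulr1.
  by rewrite -has_pred1 has_count lt0n => /negPf ->.
apply: ler_prod => e _; rewrite normr_ge0 /=.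
exact: bern_noise_moment.
Qed.

End BernoulliProduct.

(** * Sums over words *)

Section SumSeq.
Context {R : realFieldType} {T : finType}.
Implicit Types f g : seq T -> R.

(** The sum over words of length [L], arranged so that words grow at the head: a bound for the
    effect of one prepended letter can then be iterated. *)
Fixpoint sum_seq (L : nat) f : R :=
  if L is L'.+1 then sum_seq L' (fun s => \sum_v f (v :: s)) else f [::].

Lemma sum_seq_le L f g :
  (forall s, size s = L -> f s <= g s) -> sum_seq L f <= sum_seq L g.
Proof.
elim: L f g => [|L IH] f g fg /=; first exact: fg.
by apply: IH => s sL; apply: ler_sum => v _; apply: fg; rewrite /= sL.
Qed.

Lemma sum_seqZ L c f : sum_seq L (fun s => c * f s) = c * sum_seq L f.
Proof.
elim: L f => [//|L IH] f /=; rewrite -IH.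
apply/le_anti/andP; split; apply: sum_seq_le => s _; by rewrite mulr_sumr.
Qed.

Lemma eq_sum_seq L f g : f =1 g -> sum_seq L f = sum_seq L g.
Proof. by move=> fg; apply/le_anti/andP; split; apply: sum_seq_le => s _; rewrite fg. Qed.

(** The factor may depend on the current length because the first letter of a walk is chosen freely,
    whereas later ones extend the walk by a step. *)
Lemma sum_seq_growth L f (c : nat -> R) : (forall k, 0 <= c k) ->
    (forall s, (size s < L)%N -> \sum_v f (v :: s) <= c (size s) * f s) ->
  sum_seq L f <= \prod_(k < L) c k * f [::].
Proof.
move=> c0; elim: L f => [|L IH] f fc /=; first by rewrite big_ord0 mul1r.
rewrite big_ord_recr /= [_ * c L]mulrC -mulrA.
apply: (@le_trans _ _ (sum_seq L (fun s => c L * f s))).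
  by apply: sum_seq_le => s sL; rewrite -sL; apply: fc; rewrite sL.
rewrite sum_seqZ ler_wpM2l // IH // => s sL.
by apply: fc; rewrite ltnS ltnW.
Qed.

Lemma sum_seq_prod L (F : T -> R) :
  sum_seq L (fun s => \prod_(v <- s) F v) = (\sum_v F v) ^+ L.
Proof.
elim: L => [|L IH] /=; first by rewrite big_nil.
rewrite exprS -IH -sum_seqZ; apply: eq_sum_seq => s.
by rewrite mulr_suml; apply: eq_bigr => v _; rewrite big_cons.
Qed.

End SumSeq.

Lemma bern_expect_sum_seq (R : realFieldType) (I T : finType) (pr : I -> R) L
    (f : {ffun I -> bool} -> seq T -> R) :
  bern_expect pr (fun k => sum_seq L (f k)) =
  sum_seq L (fun s => bern_expect pr (fun k => f k s)).
Proof.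
elim: L f => [//|L IH] f /=; rewrite IH; apply: eq_sum_seq => s.
by rewrite bern_expect_sum.
Qed.

(** * Tail bounds for weighted sums of noise *)

Section Tails.
Context {R : realFieldType} {I : finType}.
Variable pr : I -> R.
Hypothesis pr01 : forall e, 0 <= pr e <= 1.

(* The choice of [x] balances the old and the new edges of a word. *)
Lemma balance_old_new (s V : R) (L : nat) : (0 < L)%N -> 128 * L%:R <= s ->
    128 ^+ 2 * V * L%:R <= s ^+ 2 -> 0 <= V ->
  let x := s / (128 * L%:R) in 1 <= x /\ 64 * (x * L%:R + V / x) <= s.
Proof.
move=> L0 sL sV V0 x; have L0' : 0 < L%:R :> R by rewrite ltr0n.
have s0 : 0 < s by apply: lt_le_trans sL; rewrite mulr_gt0.
split; first by rewrite ler_pdivlMr ?mul1r ?mulr_gt0.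
(* The choice of [x] makes the share of old edges exactly [s / 2]; the condition on [V] bounds the
   share of new edges by the other half. *)
have -> : 64 * (x * L%:R + V / x) = s / 2 + 128 * 64 * V * L%:R / s.
  by rewrite /x; field; rewrite !gt_eqF.
have : 128 * 64 * V * L%:R / s <= s / 2 by rewrite ler_pdivrMr //; nra.
lra.
Qed.

(** Markov's inequality for the [L]-th power, which is nonnegative as [L] is even. The power expands
    into a sum over words; prepending a letter multiplies the weight by at most [x * L + V / x], the
    first summand for letters already used, the second for new ones. Injectivity of [ed] identifies
    old edges with old letters. *)
Lemma row_sum_tail (T : finType) (ed : T -> I) (c : T -> R) (V s : R) (L : nat) :
    injective ed -> (forall v, 0 <= c v <= 1) ->
    \sum_v c v * pr (ed v) <= V -> (0 < L)%N -> ~~ odd L ->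
    128 * L%:R <= s -> 128 ^+ 2 * V * L%:R <= s ^+ 2 ->
  \sum_(k | s < `|\sum_v c v * bern_noise pr k (ed v)|) bern_weight pr k
    <= (64 ^+ L)^-1.
Proof.
move=> ed_inj c01 cV L0 Lev sL sV.
have V0 : 0 <= V.
  apply: le_trans cV; apply: sumr_ge0 => v _.
  by case/andP: (c01 v) => ? _; case/andP: (pr01 (ed v)) => ? _; apply: mulr_ge0.
have s0 : 0 < s by apply: lt_le_trans sL; rewrite mulr_gt0 // ltr0n.
have [] := balance_old_new L0 sL sV V0; move: (s / _) => x x1 xs.
have x0 : 0 < x by apply: lt_le_trans x1.
pose F k v := c v * bern_noise pr k (ed v).
apply: (@bern_markov _ _ pr pr01 (fun k => (\sum_v F k v) ^+ L) _ (s ^+ L)).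
- by move=> k; apply: exprn_even_ge0.
- move=> k /ltW sk; rewrite -[leRHS](ger0_norm (exprn_even_ge0 _ Lev)) normrX.
  by apply: lerXn2r; rewrite ?nnegrE ?normr_ge0 ?(ltW s0).
- by rewrite exprn_gt0.
rewrite (@eq_bern_expect _ _ pr _ (fun k => sum_seq L (fun t => \prod_(v <- t) F k v)));
  last first.
  by move=> k; rewrite sum_seq_prod.
rewrite bern_expect_sum_seq.
pose f t := \prod_(v <- t) c v * edge_weight pr x (map ed t).
apply: (@le_trans _ _ (sum_seq L f)).
  apply: sum_seq_le => t _; apply: le_trans (ler_norm _) _.
  rewrite (@eq_bern_expect _ _ pr _ (fun k => (\prod_(v <- t) c v) *
     \prod_(e <- map ed t) bern_noise pr k e)); last first.
    by move=> k; rewrite big_map -big_split.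
  have ct : 0 <= \prod_(v <- t) c v by apply: prodr_ge0 => v _; case/andP: (c01 v).
  rewrite bern_expectZ normrM ger0_norm //.
  by rewrite ler_wpM2l // bern_expect_noise_prod.
have step0 : 0 <= x * L%:R + V / x.
  by apply: addr_ge0; apply: mulr_ge0 => //; rewrite ?invr_ge0 (ltW x0).
apply: (@le_trans _ _ ((x * L%:R + V / x) ^+ L)); last first.
  rewrite -exprVn -exprMn; apply: lerXn2r; rewrite ?nnegrE ?mulr_ge0 ?invr_ge0 ?(ltW s0) //.
  by rewrite [leRHS]mulrC ler_pdivlMr // [leLHS]mulrC.
have -> : (x * L%:R + V / x) ^+ L = \prod_(k < L) (fun=> x * L%:R + V / x) (k : nat) * f [::].
  by rewrite prodr_const card_ord /f /edge_weight /= !big_nil expr0 !mulr1.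
apply: (@sum_seq_growth _ _ L f (fun=> x * L%:R + V / x)) => // t tL.
have ft : 0 <= f t.
  apply: mulr_ge0; last by apply: edge_weight_ge0 => //; exact: ltW.
  by apply: prodr_ge0 => v _; case/andP: (c01 v).
rewrite /= (eq_bigr (fun v => x * (c v * (if v \in t then 1 else pr (ed v) / x ^+ 2)) * f t)); last first.
  move=> v _; rewrite /f /= big_cons edge_weight_cons mem_map //; case: ifP => _; ring.
rewrite -mulr_suml ler_wpM2r // -mulr_sumr.
have -> : x * L%:R + V / x = x * (L%:R + V / x ^+ 2) by field; rewrite gt_eqF.
rewrite ler_wpM2l ?(ltW x0) //.
(* At most [size t < L] letters are old, each with [c v <= 1]; charging the new weight to every
   letter adds at most [V / x ^+ 2]. *)
apply: (@le_trans _ _ (\sum_v ((v \in t)%:R + c v * pr (ed v) / x ^+ 2))).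
  apply: ler_sum => v _; case/andP: (c01 v) => c0 c1; case/andP: (pr01 (ed v)) => p0 _.
  have w0 : 0 <= c v * pr (ed v) / x ^+ 2 by apply: divr_ge0;
    [exact: mulr_ge0 | exact/exprn_ge0/ltW].
  by case: (v \in t); rewrite /= ?mulr1n ?mulr0n ?mulr1 ?add0r ?mulrA //; lra.
rewrite big_split -mulr_suml lerD //; last by rewrite ler_wpM2r // invr_ge0;
  exact/exprn_ge0/ltW.
rewrite -natr_sum ler_nat -big_mkcond sum1_card (leq_trans (card_size t)) //; exact: ltnW.
Qed.
End Tails.

(** * Moments of random symmetric matrices *)

Lemma trmx_exp (R : comPzRingType) n (N : 'M[R]_n) k : (N ^+ k)^T = N^T ^+ k.
Proof.
elim: k => [|k IH]; first by rewrite !expr0 trmx1.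
by rewrite exprS exprSr -IH; exact: trmx_mul.
Qed.

Lemma trace_sym_power (R : comPzRingType) n (N : 'M[R]_n) h : N^T = N ->
  \tr (N ^+ (h + h)) = \sum_u \sum_v ((N ^+ h) u v) ^+ 2.
Proof.
move=> N_sym; rewrite exprD; apply: eq_bigr => u _; rewrite mxE.
apply: eq_bigr => v _; rewrite expr2; congr (_ * _).
by rewrite -{1}N_sym -trmx_exp mxE.
Qed.

(** By the Lagrange identity, twice the difference of the two sides is the double sum of the squares
    of [a i * b j - a j * b i]. *)
Lemma cauchy_schwarz_sum (R : realDomainType) (T : finType) (a b : T -> R) :
  (\sum_i a i * b i) ^+ 2 <= (\sum_i a i ^+ 2) * (\sum_i b i ^+ 2).
Proof.
rewrite -subr_ge0 -(pmulrn_lge0 _ (ltn0Sn 1)).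
have -> : ((\sum_i a i ^+ 2) * (\sum_i b i ^+ 2) - (\sum_i a i * b i) ^+ 2) *+ 2 =
    \sum_i \sum_j (a i * b j - a j * b i) ^+ 2.
  rewrite mulr2n; pose s := \sum_i \sum_j a i ^+ 2 * b j ^+ 2.
  have sE : (\sum_i a i ^+ 2) * (\sum_i b i ^+ 2) = s.
    by rewrite mulr_suml; apply: eq_bigr => i _; rewrite mulr_sumr.
  have sE' : s = \sum_i \sum_j a j ^+ 2 * b i ^+ 2 by rewrite /s exchange_big.
  have tE : (\sum_i a i * b i) ^+ 2 = \sum_i \sum_j (a i * b i) * (a j * b j).
    by rewrite expr2 mulr_suml; apply: eq_bigr => i _; rewrite mulr_sumr.
  rewrite sE tE {1}sE' /s -!sumrB -big_split; apply: eq_bigr => i _ /=.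
  by rewrite -!sumrB -big_split; apply: eq_bigr => j _ /=; ring.
by apply: sumr_ge0 => i _; apply: sumr_ge0 => j _; exact: sqr_ge0.
Qed.

(* Repeated Cauchy-Schwarz: [(v N v^T) ^ 2 <= |v|^2 (v N^2 v^T)]. *)
Lemma trace_power_quadratic (R : realFieldType) n (N : 'M[R]_n) (J : nat) (s : R)
    (v : 'rV[R]_n) : N^T = N -> 0 <= s -> \tr (N ^+ (2 ^ J.+1)) <= s ^+ (2 ^ J.+1) ->
  (v *m N *m v^T) 0 0 <= s * (v *m v^T) 0 0.
Proof.
move=> N_sym s0 trN; rewrite leNgt; apply/negP => q0.
pose w := (v *m v^T) 0 0; pose q j := (v *m N ^+ (2 ^ j) *m v^T) 0 0.
have sqE m (x : 'rV[R]_m) : (x *m x^T) 0 0 = \sum_i x 0 i ^+ 2.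
  by rewrite mxE; apply: eq_bigr => i _; rewrite mxE expr2.
have w0 : 0 <= w by rewrite /w sqE; apply: sumr_ge0 => i _; exact: sqr_ge0.
have qS j : q j.+1 = \sum_i ((v *m N ^+ (2 ^ j)) 0 i) ^+ 2.
  rewrite -sqE trmx_mul trmx_exp N_sym mulmxA /q expnS mul2n -addnn.
  have -> : N ^+ (2 ^ j + 2 ^ j) = N ^+ (2 ^ j) *m N ^+ (2 ^ j) by exact: exprD.
  by rewrite mulmxA.
have w_gt0 : 0 < w.
  rewrite lt_neqAle w0 andbT; apply/eqP => we; move: q0.
  rewrite -/w -we mulr0 => q0.
  have v0 i : v 0 i = 0.
    apply/eqP; rewrite -sqrf_eq0 eq_le sqr_ge0 andbT [leRHS]we /w sqE (bigD1 i) //=.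
    by rewrite lerDl; apply: sumr_ge0 => j _; exact: sqr_ge0.
  suff v00 : v = 0 by move: q0; rewrite v00 mul0mx mul0mx mxE ltxx.
  by apply/rowP => i; rewrite v0 mxE.
(* If the claim fails, squaring carries the strict inequality from exponent [2 ^ j] to [2 ^ j.+1];
   one may divide by [w] since [v] is nonzero. *)
have step j : s ^+ (2 ^ j) * w < q j.
  elim: j => [|j IH]; first by rewrite /q expn0 !expr1.
  have qq : q j ^+ 2 <= w * q j.+1.
    rewrite qS /w sqE /q; apply: le_trans (cauchy_schwarz_sum _ _).
    rewrite mxE (eq_bigr (fun i => v 0 i * (v *m N ^+ (2 ^ j)) 0 i)) // => i _.
    by rewrite [v^T _ _]mxE mulrC.
  have sw0 : 0 <= s ^+ (2 ^ j) * w by rewrite mulr_ge0 // exprn_ge0.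
  have : (s ^+ (2 ^ j) * w) ^+ 2 < w * q j.+1.
    by apply: lt_le_trans qq; rewrite ltr_pXn2r // nnegrE // (le_trans sw0) // ltW.
  rewrite exprMn -exprM (mulnC _ 2%N) -expnS (expr2 w) mulrA [ltLHS]mulrC.
  by rewrite ltr_pM2l.
(* At exponent [2 ^ J.+1] the form is at most [w] times the trace, which is the squared Frobenius
   norm of [N ^+ (2 ^ J)]. *)
have := step J.+1; apply/negP; rewrite -leNgt; apply: le_trans (ler_wpM2r w0 trN).
rewrite qS expnS mul2n -addnn trace_sym_power // exchange_big mulr_suml /=.
apply: ler_sum => i _; rewrite mxE mulrC /w sqE; exact: cauchy_schwarz_sum.
Qed.

(** * Walks and traces of powers *)

Section Walks.
Context {R : realFieldType} {n : nat}.

Fixpoint walk_prod (N : 'I_n -> 'I_n -> R) (s : seq 'I_n) : R :=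
  if s is u :: ((v :: _) as t) then N u v * walk_prod N t else 1.

Fixpoint walk_edges (I : eqType) (ed : 'I_n -> 'I_n -> I) (s : seq 'I_n) : seq I :=
  if s is u :: ((v :: _) as t) then ed u v :: walk_edges ed t else [::].

Lemma walk_prod_cons N u v s :
  walk_prod N [:: u, v & s] = N u v * walk_prod N (v :: s).
Proof. by []. Qed.

(** A walk with [L] steps has [L.+1] letters. Its end points enter through an arbitrary [g], so that
    the induction can absorb the first step into [g']; they are options because a word may be
    empty. *)
Lemma sum_seq_walk_prod L (N : 'M[R]_n) (g : option 'I_n -> option 'I_n -> R) :
  sum_seq L.+1 (fun s => g (ohead s) (ohead (rev s)) * walk_prod N s) =
  \sum_u \sum_v g (Some u) (Some v) * (N ^+ L) u v.
Proof.
elim: L g => [|L IH] g.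
  rewrite /= expr0; apply: eq_bigr => u _.
  rewrite (bigD1 u) //= mxE eqxx big1 ?addr0 // => v /negPf uv.
  by rewrite mxE eq_sym uv mulr0.
pose g' (u v : option 'I_n) := if u is Some u' then
  \sum_w g (Some w) v * N w u' else 0.
transitivity (\sum_u \sum_v g' (Some u) (Some v) * (N ^+ L) u v); last first.
  transitivity (\sum_u \sum_v \sum_w g (Some w) (Some v) * N w u * (N ^+ L) u v).
    by apply: eq_bigr => u _; apply: eq_bigr => v _; rewrite /g' mulr_suml.
  rewrite exchange_big /= [RHS]exchange_big /=; apply: eq_bigr => v _.
  rewrite exchange_big /=; apply: eq_bigr => w _; rewrite exprS mxE mulr_sumr.
  by apply: eq_bigr => u _; rewrite mulrA.
rewrite -IH.
change (sum_seq L.+1 (fun s => \sum_w g (ohead (w :: s)) (ohead (rev (w :: s))) *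
  walk_prod N (w :: s)) = sum_seq L.+1 (fun s => g' (ohead s) (ohead (rev s)) * walk_prod N s)).
suff H s : size s = L.+1 ->
    \sum_w g (ohead (w :: s)) (ohead (rev (w :: s))) * walk_prod N (w :: s) =
    g' (ohead s) (ohead (rev s)) * walk_prod N s.
  by apply/le_anti/andP; split; apply: sum_seq_le => s /H ->.
case: s => // u s _; rewrite /= mulr_suml; apply: eq_bigr => w _.
rewrite rev_cons -mulrA; congr (g _ _ * _).
by rewrite rev_cons -cats1; case: (rev s).
Qed.

Section Tail.
Context {I : finType}.
Variable pr : I -> R.
Hypothesis pr01 : forall e, 0 <= pr e <= 1.
Variable ed : 'I_n -> 'I_n -> I.
Hypothesis ed_sym : forall u v, ed u v = ed v u.
Hypothesis ed_end : forall u v a b, ed u v = ed a b -> u = a \/ u = b.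

(** This counts the old edges: prepending [v] along an old edge forces [v] to be a letter already
    visited. *)
Lemma mem_walk_edges u v s : ed u v \in walk_edges ed s -> u \in s.
Proof.
elim: s => [//|a [//|b s] IH].
rewrite /= in_cons => /orP[/eqP /ed_end [] ->|/IH H].
- by rewrite in_cons eqxx.
- by rewrite !in_cons eqxx orbT.
by rewrite in_cons H orbT.
Qed.

Lemma walk_prod_noise c k s :
  walk_prod (fun u v => c u v * bern_noise pr k (ed u v)) s =
  walk_prod c s * \prod_(e <- walk_edges ed s) bern_noise pr k e.
Proof.
elim: s => [|a [|b s] IH]; rewrite ?big_nil ?mulr1 //.
rewrite !walk_prod_cons IH /= big_cons; ring.
Qed.

(** The moment method for the trace. The sum over closed walks is enlarged to all walks; the first
    letter then has [n] choices, and each step multiplies the weight by at most [x * L + V / x], as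
    for row sums. *)
Lemma trace_power_tail (c : 'I_n -> 'I_n -> R) (V s : R) (L : nat) :
    (forall u v, 0 <= c u v <= 1) ->
    (forall u v, c u v = c v u) ->
    (forall u, \sum_v c v u * pr (ed v u) <= V) -> 0 <= V -> (0 < L)%N -> ~~ odd L ->
    128 * L%:R <= s -> 128 ^+ 2 * V * L%:R <= s ^+ 2 ->
  \sum_(k | s ^+ L <= \tr ((\matrix_(u, v) (c u v * bern_noise pr k (ed u v))) ^+ L))
      bern_weight pr k
    <= n%:R * (64 ^+ L)^-1.
Proof.
move=> c01 c_sym cV V0 L0 Lev sL sV.
have s0 : 0 < s by apply: lt_le_trans sL; rewrite mulr_gt0 // ltr0n.
have [] := balance_old_new L0 sL sV V0; move: (s / _) => x x1 xs.
have x0 : 0 < x by apply: lt_le_trans x1.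
pose N k : 'M[R]_n := \matrix_(u, v) (c u v * bern_noise pr k (ed u v)).
pose g (u v : option 'I_n) : R := (u == v)%:R.
have trE k : \tr (N k ^+ L) =
    sum_seq L.+1 (fun t => g (ohead t) (ohead (rev t)) * walk_prod (N k) t).
  rewrite sum_seq_walk_prod; apply: eq_bigr => u _.
  rewrite (bigD1 u) //= /g eqxx mul1r big1 ?addr0 // => v /negPf uv.
  by rewrite (_ : (Some u == Some v) = false) ?mul0r // eq_sym.
pose f t := walk_prod c t * edge_weight pr x (walk_edges ed t).
have c_ge0 t : 0 <= walk_prod c t.
  elim: t => [|a [|b t] IH] //=; apply: mulr_ge0 => //.
  by case/andP: (c01 a b).
have fge0 t : 0 <= f t by apply/mulr_ge0/edge_weight_ge0 => //; exact: ltW.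
have Ef t : `|bern_expect pr (fun k => g (ohead t) (ohead (rev t)) * walk_prod (N k) t)| <= f t.
  (* Here the closedness of the walk is given up: [g] takes the values 0 and 1. *)
  rewrite bern_expectZ normrM; apply: (@le_trans _ _ (1 * f t)); last by rewrite mul1r.
  apply: ler_pM => //; first by rewrite /g; case: eqP => _; rewrite ?normr1 ?normr0.
  rewrite (@eq_bern_expect _ _ pr _ (fun k => walk_prod c t *
     \prod_(e <- walk_edges ed t) bern_noise pr k e)); last first.
    move=> k; rewrite -walk_prod_noise.
    by elim: t => [|a [|b t] IH] //=; rewrite mxE [X in _ * X = _]IH.
  by rewrite bern_expectZ normrM ger0_norm // ler_wpM2l // bern_expect_noise_prod.
have ftot : sum_seq L.+1 f <= n%:R * (x * L%:R + V / x) ^+ L.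
  have step0 : 0 <= x * L%:R + V / x.
    by apply: addr_ge0; apply: mulr_ge0 => //; rewrite ?invr_ge0 (ltW x0).
  pose cc (k : nat) := if k is 0%N then n%:R else x * L%:R + V / x.
  have -> : n%:R * (x * L%:R + V / x) ^+ L = \prod_(k < L.+1) cc k * f [::].
    rewrite big_ord_recl /= prodr_const card_ord /f /edge_weight /= big_nil expr0.
    by rewrite !mulr1.
  apply: sum_seq_growth => [[|k]|t tL]; rewrite /cc ?ler0n //.
  case: t tL => [_|a t tL].
    rewrite /f /= /edge_weight /= big_nil expr0 !mulr1.
    by rewrite sumr_const card_ord.
  rewrite (eq_bigr (fun v => x * (c v a * (if ed v a \in walk_edges ed (a :: t) then 1
      else pr (ed v a) / x ^+ 2)) * f (a :: t))); last first.
    move=> v _; rewrite /f walk_prod_cons.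
    rewrite -[walk_edges ed (v :: _)]/(ed v a :: walk_edges ed (a :: t)) edge_weight_cons.
    by case: ifP => _; ring.
  rewrite -mulr_suml ler_wpM2r // -mulr_sumr.
  have -> : x * L%:R + V / x = x * (L%:R + V / x ^+ 2) by field; rewrite gt_eqF.
  rewrite ler_wpM2l ?(ltW x0) //.
  apply: (@le_trans _ _ (\sum_v ((v \in a :: t)%:R + c v a * pr (ed v a) / x ^+ 2))).
    apply: ler_sum => v _; case/andP: (c01 v a) => c0 c1; case/andP: (pr01 (ed v a)) => p0 _.
    have w0 : 0 <= c v a * pr (ed v a) / x ^+ 2.
      by apply: divr_ge0; [exact: mulr_ge0 | exact/exprn_ge0/ltW].
    case: ifP => [/mem_walk_edges ->|_]; first by rewrite mulr1 mulr1n; lra.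
    by rewrite mulrA lerDr.
  rewrite big_split -mulr_suml lerD //; last by rewrite ler_wpM2r // invr_ge0;
    exact/exprn_ge0/ltW.
  by rewrite -natr_sum ler_nat -big_mkcond sum1_card (leq_trans (card_size _)).
apply: (@bern_markov _ _ pr pr01 (fun k => \tr (N k ^+ L)) _ (s ^+ L)) => //.
- move=> k; rewrite -[L]odd_double_half (negPf Lev) add0n -addnn trace_sym_power.
    by apply: sumr_ge0 => u _; apply: sumr_ge0 => v _; exact: sqr_ge0.
  by apply/matrixP => u v; rewrite !mxE c_sym ed_sym.
- by rewrite exprn_gt0.
rewrite (eq_bern_expect pr trE) bern_expect_sum_seq.
apply: (@le_trans _ _ (sum_seq L.+1 f)).
  by apply: sum_seq_le => t _; exact: le_trans (ler_norm _) (Ef t).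
apply: le_trans ftot _; rewrite -mulrA ler_wpM2l //.
rewrite -exprVn -exprMn; apply: lerXn2r.
- rewrite nnegrE; apply: addr_ge0; apply: mulr_ge0 => //; rewrite ?invr_ge0 (ltW x0) //.
- by rewrite nnegrE mulr_ge0 ?invr_ge0 ?(ltW s0).
by rewrite [leRHS]mulrC ler_pdivlMr // [leLHS]mulrC.
Qed.
End Tail.
End Walks.

(** * Gram representation and the outlier program *)

(** Cholesky factorization by induction on the size. A zero corner [a] forces the column [b] below
    it to vanish; otherwise the induction applies to the Schur complement of [a]. *)
Lemma psd_gram (R : rcfType) n (X : 'M[R]_n) : X^T = X ->
    (forall v : 'cV[R]_n, 0 <= (v^T *m X *m v) 0 0) ->
  exists G : 'M[R]_n, X = G *m G^T.
Proof.
elim: n X => [|n IH] X X_sym X_psd.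
  by exists 0; apply/matrixP => -[].
rewrite -[n.+1]/(1 + n)%N in X X_sym X_psd *.
pose a := X 0 0; pose b : 'cV[R]_n := dlsubmx X; pose D : 'M[R]_n := drsubmx X.
have XE : X = block_mx a%:M b^T b D.
  rewrite -[LHS](@submxK _ 1 n 1 n); congr block_mx.
    apply/matrixP => i j; rewrite !ord1 !mxE eqxx mulr1n; congr (X _ _); exact/val_inj.
  by rewrite /b trmx_dlsub X_sym.
have D_sym : D^T = D by rewrite /D trmx_drsub X_sym.
have quad (t : R) (y : 'cV[R]_n) :
    ((col_mx t%:M y)^T *m X *m col_mx t%:M y) 0 0 =
    a * t ^+ 2 + (b^T *m y) 0 0 * t *+ 2 + (y^T *m D *m y) 0 0.
  rewrite XE tr_col_mx mul_row_block mul_row_col tr_scalar_mx !mulmxDl.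
  rewrite !mul_scalar_mx !mul_mx_scalar -!scalemxAl.
  have -> : y^T *m b = (b^T *m y)^T by rewrite trmx_mul trmxK.
  move: (b^T *m y) (y^T *m D *m y) => p w; rewrite !mxE eqxx mulr1n; ring.
have a0 : 0 <= a.
  by have := X_psd (col_mx 1%:M 0); rewrite quad !mulmx0 !mxE mul0r mul0rn !addr0 expr1n mulr1.
have [a_eq0|a_neq0] := eqVneq a 0.
- have b0 : b = 0.
    apply/colP => i; rewrite [RHS]mxE; apply/eqP/negPn/negP => bi0.
    pose e : 'cV[R]_n := delta_mx i 0.
    have be : (b^T *m e) 0 0 = b i 0 by rewrite -colE !mxE.
    pose d := (e^T *m D *m e) 0 0.
    (* With [a = 0] the form is affine in the first coordinate, and this choice gives it the value
       -1. *)
    have := X_psd (col_mx (- (d + 1) / (b i 0 *+ 2))%:M e).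
    rewrite quad be a_eq0 mul0r add0r -/d -mulrnAl mulrC divfK ?mulrn_eq0 //.
    by rewrite opprD addrAC addNr add0r oppr_ge0 ler10.
  have [G DE] : exists G : 'M[R]_n, D = G *m G^T.
    apply: IH => // y; have := X_psd (col_mx 0%:M y).
    by rewrite quad expr0n /= !mulr0 mul0rn !add0r.
  exists (block_mx 0 0 0 G).
  by rewrite XE a_eq0 b0 tr_block_mx mulmx_block !trmx0 !mulmx0 !mul0mx !add0r -DE raddf0.
have a_gt0 : 0 < a by rewrite lt_neqAle eq_sym a_neq0.
have [G DE] : exists G : 'M[R]_n, D - a^-1 *: (b *m b^T) = G *m G^T.
  apply: IH => [|y].
    by rewrite linearB /= linearZ /= trmx_mul trmxK D_sym.
  (* This first coordinate minimizes the form for given [y]; the minimum is the form of the Schur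
     complement. *)
  have := X_psd (col_mx (- (b^T *m y) 0 0 / a)%:M y); rewrite quad.
  set s := (b^T *m y) 0 0; rewrite mulmxBr mulmxBl -scalemxAr -scalemxAl mulmxA.
  rewrite -[y^T *m b *m b^T *m y]mulmxA.
  have -> : y^T *m b = (b^T *m y)^T by rewrite trmx_mul trmxK.
  rewrite [X in _ -> 0 <= X]mxE.
  have -> : (- (a^-1 *: ((b^T *m y)^T *m (b^T *m y)))) 0 0 = - (s ^+ 2 / a).
    by rewrite 3!mxE big_ord1 mxE -/s; ring.
  move=> H; apply: (le_trans H); rewrite le_eqVlt; apply/orP; left; apply/eqP; field.
  by [].
pose r := Num.sqrt a; have r0 : r != 0 by rewrite sqrtr_eq0 -ltNge.
have rr : r * r = a by rewrite -expr2 sqr_sqrtr.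
exists (block_mx r%:M 0 (r^-1 *: b) G).
rewrite XE tr_block_mx mulmx_block !trmx0 !mulmx0 !mul0mx tr_scalar_mx linearZ /=.
rewrite !addr0 -DE -scalar_mxM rr mul_scalar_mx mul_mx_scalar !scalerA mulfV // !scale1r.
rewrite -scalemxAl -scalemxAr scalerA -invfM rr.
by rewrite addrC subrK.
Qed.

Lemma continuous_sum (R : realType) (T : topologicalType) (I : finType)
    (f : I -> T -> R) :
  (forall i, continuous (f i)) -> continuous (fun x => \sum_i f i x).
Proof.
move=> fc; apply: (@continuous_big R I +%R) => // x; exact: add_continuous.
Qed.

(** * The quadratic program of the outliers *)

Section QP.
Context {R : realType} {r m : nat}.
Variables (e : 'I_r -> 'I_m -> R) (Q : 'I_m -> 'I_m -> R).
Implicit Types z : 'I_r -> 'I_m -> R.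

(** Each column of [z] lies in the nonnegative part of the unit ball, which keeps the inner products
    of columns between 0 and 1. *)
Definition quarter_ball z : Prop :=
  (forall i b, 0 <= z i b) /\ (forall b, \sum_i z i b ^+ 2 <= 1).

(** The outlier part of the semidefinite cost of the comparison matrix; the factor 2 counts both
    off-diagonal blocks. *)
Definition qp_cost z : R :=
  2 * (\sum_i \sum_b e i b * z i b) + \sum_i \sum_b \sum_c Q b c * z i b * z i c.

Lemma qp_min_exists :
  exists z, quarter_ball z /\ forall z', quarter_ball z' -> qp_cost z <= qp_cost z'.
Proof.
pose zof (v : 'rV[R]_(r * m)) i b := v 0 (mxvec_index i b).
have zc i b : continuous (fun v => zof v i b) by exact: coord_continuous.
have zofK z : exists v, zof v = z.
  exists (mxvec (\matrix_(i, b) z i b)); apply/funext => i; apply/funext => b.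
  by rewrite /zof mxvecE mxE.
pose A : set 'rV[R]_(r * m) := [set v | quarter_ball (zof v)].
have A_closed : closed A.
  have -> : A = \bigcap_(i in [set: 'I_r]) \bigcap_(b in [set: 'I_m])
        ((fun v => zof v i b) @^-1` [set x | 0 <= x]) `&`
      \bigcap_(b in [set: 'I_m]) ((fun v => \sum_i zof v i b ^+ 2) @^-1` [set x | x <= 1]).
    apply/seteqP; split => v /=.
      by case=> v0 v1; split=> [i _ b _|b _] /=; [exact: v0|exact: v1].
    by case=> v0 v1; split=> [i b|b]; [exact: v0|exact: v1].
  apply: closedI; last first.
    apply: closed_bigI => b _; apply: preimage_closed; last exact: closed_le.
    move=> v _; move: v; apply: continuous_sum => i v.
    by apply: (@continuousM R _ (fun v => zof v i b) (fun v => zof v i b)); exact: zc.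
  apply: closed_bigI => i _; apply: closed_bigI => b _.
  by apply: preimage_closed; [move=> v _; exact: zc|exact: closed_ge].
have A_compact : compact A.
  have box_compact : compact [set v : 'rV[R]_(r * m) | forall k, v ord0 k \in `[0, 1]].
    apply: (@rV_compact _  _ (fun=> `[0, (1:R)]%classic)).
    by move=> _; apply: segment_compact.
  apply: subclosed_compact A_closed box_compact _.
  move=> v [v0 v1] k /=; case/mxvec_indexP: k => i b.
  rewrite in_itv /= [_ <= _]v0 /= -(@ler_pXn2r _ 2) ?nnegrE ?v0 // expr1n.
  apply: le_trans (v1 b); rewrite (bigD1 i) //= lerDl.
  by apply: sumr_ge0 => j _; exact: sqr_ge0.
have cost_cont : continuous (fun v => qp_cost (zof v)).
  have c1 : continuous (fun v => \sum_i \sum_b e i b * zof v i b).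
    apply: continuous_sum => i; apply: continuous_sum => b v.
    by apply: continuousM; [exact: cst_continuous|exact: zc].
  have c2 : continuous (fun v => \sum_i \sum_b \sum_c Q b c * zof v i b * zof v i c).
    apply: continuous_sum => i; apply: continuous_sum => b.
    apply: continuous_sum => c v; apply: (@continuousM R _ (fun v => Q b c * zof v i b));
      last exact: zc.
    by apply: continuousM; [exact: cst_continuous|exact: zc].
  move=> v; exact: (cvgD (cvgM (cvg_cst (2 : R)) (c1 v)) (c2 v)).
have [|v] := compact_EVT_min _ A_compact (continuous_subspaceT cost_cont).
  have [v ve] := zofK (fun _ _ => 0); exists v; rewrite /A /= ve.
  by split=> [//|b]; rewrite big1 // => i _; rewrite expr0n.
rewrite inE => vA vmin; exists (zof v); split=> // z' zA.
by have [v' ve] := zofK z'; rewrite -ve; apply: vmin; rewrite inE /A /= ve.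
Qed.
End QP.

Section KKT.
Context {R : realType} {r m : nat}.
Variables (e : 'I_r -> 'I_m -> R) (Q : 'I_m -> 'I_m -> R).
Hypothesis Q_sym : forall b c, Q b c = Q c b.

(** Half the gradient of [qp_cost], as [Q] is symmetric. *)
Definition qp_grad (z : 'I_r -> 'I_m -> R) i b := e i b + \sum_c Q b c * z i c.

Lemma qp_cost_perturb z d (t : R) :
  qp_cost e Q (fun i b => z i b + t * d i b) = qp_cost e Q z +
    t * (2 * \sum_i \sum_b qp_grad z i b * d i b) +
    t ^+ 2 * \sum_i \sum_b \sum_c Q b c * d i b * d i c.
Proof.
have eE : \sum_i \sum_b e i b * (z i b + t * d i b) =
    \sum_i \sum_b e i b * z i b + t * \sum_i \sum_b e i b * d i b.
  rewrite mulr_sumr -big_split; apply: eq_bigr => i _ /=.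
  by rewrite mulr_sumr -big_split; apply: eq_bigr => b _ /=; ring.
have gE : \sum_i \sum_b qp_grad z i b * d i b = \sum_i \sum_b e i b * d i b +
    \sum_i \sum_b \sum_c Q b c * z i c * d i b.
  rewrite -big_split; apply: eq_bigr => i _ /=.
  rewrite -big_split; apply: eq_bigr => b _ /=.
  by rewrite /qp_grad mulrDl mulr_suml.
have sw : \sum_i \sum_b \sum_c Q b c * z i c * d i b =
    \sum_i \sum_b \sum_c Q b c * z i b * d i c.
  apply: eq_bigr => i _; rewrite exchange_big; apply: eq_bigr => b _.
  by apply: eq_bigr => c _; rewrite Q_sym.
have QE : \sum_i \sum_b \sum_c Q b c * (z i b + t * d i b) * (z i c + t * d i c) =
    \sum_i \sum_b \sum_c Q b c * z i b * z i c +
    t * (\sum_i \sum_b \sum_c Q b c * z i c * d i b +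
         \sum_i \sum_b \sum_c Q b c * z i b * d i c) +
    t ^+ 2 * \sum_i \sum_b \sum_c Q b c * d i b * d i c.
  rewrite -big_split !mulr_sumr -!big_split; apply: eq_bigr => i _ /=.
  rewrite -big_split !mulr_sumr -!big_split; apply: eq_bigr => b _ /=.
  rewrite -big_split !mulr_sumr -!big_split; apply: eq_bigr => c _ /=.
  by ring.
by rewrite /qp_cost eE QE gE -sw; ring.
Qed.

Lemma quadratic_nonneg_slope (a b : R) :
  (forall t, 0 < t <= 1 -> 0 <= t * a + t ^+ 2 * b) -> 0 <= a.
Proof.
move=> H; rewrite leNgt; apply/negP => a0.
pose M := `|b| + `|a|; have M0 : 0 < M by rewrite ltr_wpDl // normr_gt0 lt_eqF.
(* Small enough for [t * b <= |a| / 2]; the summand [|a|] of [M] keeps [t <= 1]. *)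
pose t := `|a| / (2 * M).
have t0 : 0 < t by rewrite divr_gt0 ?normr_gt0 ?lt_eqF // mulr_gt0.
have t1 : t <= 1 by rewrite ler_pdivrMr ?mulr_gt0 // mul1r /M; have := normr_ge0 b;
  have := normr_ge0 a; lra.
have := H t; rewrite t0 t1 => /(_ isT); apply/negP; rewrite -ltNge.
rewrite expr2 -mulrA -mulrDr pmulr_rlt0 //.
have tb : t * b <= `|a| / 2.
  apply: (@le_trans _ _ (t * M)).
    by rewrite ler_pM2l // /M; have := ler_norm b; have := normr_ge0 a; lra.
  by rewrite /t invfM mulrA -mulrA mulVf ?gt_eqF // mulr1.
by move: tb; rewrite ltr0_norm //; lra.
Qed.

(* [z] is the minimizer of a linear form [g] over the quarter ball, hence
   [nu *: z] is the negative part of [g], where [nu] is its norm. *)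
Lemma quarter_ball_vi (g z : 'I_r -> R) : (forall i, 0 <= z i) -> \sum_i z i ^+ 2 <= 1 ->
    (forall w : 'I_r -> R, (forall i, 0 <= w i) -> \sum_i w i ^+ 2 <= 1 ->
      \sum_i g i * z i <= \sum_i g i * w i) ->
  exists nu, [/\ 0 <= nu, forall i, 0 <= g i + nu * z i,
     forall i, (g i + nu * z i) * z i = 0 & nu * \sum_i z i ^+ 2 = nu].
Proof.
move=> z0 z1 vi.
(* [h] is the negative part of [g] and [p] its positive part; their supports are disjoint. *)
pose h i := Num.max (- g i) 0; have h0 i : 0 <= h i by rewrite le_max lexx orbT.
pose p i := g i + h i.
have p0 i : 0 <= p i by rewrite /p /h; case: (lerP (- g i) 0); lra.
have hp i : h i * p i = 0 by rewrite /p /h; case: (lerP (- g i) 0) => _; ring.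
pose nu := Num.sqrt (\sum_i h i ^+ 2).
have nu2 : nu ^+ 2 = \sum_i h i ^+ 2.
  by rewrite sqr_sqrtr //; apply: sumr_ge0 => i _; exact: sqr_ge0.
have nu_ge0 : 0 <= nu by exact: sqrtr_ge0.
have gz : \sum_i g i * z i = \sum_i p i * z i - \sum_i h i * z i.
  by rewrite -sumrB; apply: eq_bigr => i _; rewrite /p; ring.
have pz0 : 0 <= \sum_i p i * z i by apply: sumr_ge0 => i _; exact: mulr_ge0.
have hz_le : \sum_i h i * z i <= nu.
  rewrite -(@ler_pXn2r _ 2) ?nnegrE //; last by apply: sumr_ge0 => i _; exact: mulr_ge0.
  apply: le_trans (cauchy_schwarz_sum _ _) _; rewrite -nu2 ler_piMr ?sqr_ge0 //.
(* Comparison with the unit vector [h / nu], or with 0 if [nu = 0]. *)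
have gz_le : \sum_i g i * z i <= - nu.
  have [nu0|nu_neq0] := eqVneq nu 0.
    rewrite nu0 oppr0; have := vi (fun=> 0) (fun=> lexx _).
    rewrite big1 => [/(_ ler01)|i _]; last by rewrite expr0n.
    by rewrite [X in _ <= X]big1 // => i _; rewrite mulr0.
  have nu_gt0 : 0 < nu by rewrite lt_neqAle eq_sym nu_neq0.
  apply: le_trans (vi (fun i => h i / nu) _ _) _.
  - by move=> i; rewrite divr_ge0.
  - under eq_bigr do rewrite expr_div_n.
    by rewrite -mulr_suml -nu2 divff // expf_neq0.
  rewrite -(ler_pM2r nu_gt0) mulr_suml mulNr -expr2 nu2 -sumrN.
  apply: ler_sum => i _; rewrite mulrA divfK //.
  by have := hp i; rewrite /p mulrDr -expr2 [g i * _]mulrC; lra.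
have hz : \sum_i h i * z i = nu by apply/le_anti; rewrite hz_le /=; lra.
have pz : \sum_i p i * z i = 0 by apply/le_anti; rewrite pz0 andbT; lra.
(* Equality case of Cauchy-Schwarz: the squares of [h i - nu * z i] add up to at most
   [nu^2 - 2 nu^2 + nu^2 = 0]. *)
have nuz i : nu * z i = h i.
  suff /eqP : (h i - nu * z i) ^+ 2 = 0 by rewrite sqrf_eq0 subr_eq0 => /eqP.
  apply/le_anti; rewrite sqr_ge0 andbT.
  apply: (@le_trans _ _ (\sum_i (h i - nu * z i) ^+ 2)).
    by rewrite (bigD1 i) //= lerDl; apply: sumr_ge0 => j _; exact: sqr_ge0.
  have -> : \sum_i (h i - nu * z i) ^+ 2 =
      \sum_i h i ^+ 2 - 2 * nu * (\sum_i h i * z i) + nu ^+ 2 * \sum_i z i ^+ 2.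
    by rewrite !mulr_sumr -sumrB -big_split; apply: eq_bigr => j _ /=; ring.
  rewrite -nu2 hz.
  have : nu ^+ 2 * \sum_i z i ^+ 2 <= nu ^+ 2 by rewrite ler_piMr ?sqr_ge0.
  by rewrite -mulrA -expr2; lra.
exists nu; split=> // [i|i|].
- by rewrite nuz; exact: p0.
- rewrite nuz -/(p i); apply/le_anti; rewrite mulr_ge0 // andbT -pz (bigD1 i) //= lerDl.
  by apply: sumr_ge0 => j _; exact: mulr_ge0.
have [->|nu_neq0] := eqVneq nu 0; first by rewrite mul0r.
apply: (mulfI nu_neq0); rewrite mulrA -!expr2 [RHS]nu2 mulr_sumr.
by apply: eq_bigr => i _; rewrite -nuz exprMn.
Qed.

(** Stationarity is used one outlier at a time: moving column [b] of a minimizer along a segment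
    inside the convex constraint set gives the inequality of [quarter_ball_vi], which supplies the
    multiplier [nu b]. *)
Lemma qp_kkt : exists z nu,
  [/\ quarter_ball z, forall b, 0 <= nu b,
    forall i b, 0 <= qp_grad z i b + nu b * z i b,
    forall i b, (qp_grad z i b + nu b * z i b) * z i b = 0 &
    forall b, nu b * \sum_i z i b ^+ 2 = nu b].
Proof.
have [z [[z0 z1] zmin]] := qp_min_exists e Q.
have H b : exists nu, [/\ 0 <= nu, forall i, 0 <= qp_grad z i b + nu * z i b,
    forall i, (qp_grad z i b + nu * z i b) * z i b = 0 &
    nu * \sum_i z i b ^+ 2 = nu].
  apply: quarter_ball_vi => // w w0 w1; rewrite -subr_ge0 -sumrB.
  pose d i c := (c == b)%:R * (w i - z i b).
  have gd : \sum_i \sum_c qp_grad z i c * d i c =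
      \sum_i (qp_grad z i b * w i - qp_grad z i b * z i b).
    apply: eq_bigr => i _; rewrite (bigD1 b) //= big1 ?addr0 => [|c /negPf cb].
      by rewrite /d eqxx /= mulr1n; ring.
    by rewrite /d cb mul0r mulr0.
  rewrite -gd -(@pmulr_rge0 _ 2) //.
  apply: (@quadratic_nonneg_slope _ (\sum_i \sum_b \sum_c Q b c * d i b * d i c)).
  move=> t /andP[t0 t1].
  have zt : quarter_ball (fun i c => z i c + t * d i c).
    split=> [i c|c]; rewrite /d; have [->|cb] := eqVneq c b.
    - by rewrite mul1r; have := z0 i b; have := w0 i; nra.
    - by rewrite mul0r mulr0 addr0.
    - apply: (@le_trans _ _ ((1 - t) * \sum_i z i b ^+ 2 + t * \sum_i w i ^+ 2)).
        rewrite !mulr_sumr -big_split; apply: ler_sum => i _ /=.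
        have := mulr_ge0 (mulr_ge0 (ltW t0) (_ : 0 <= 1 - t)) (sqr_ge0 (w i - z i b)).
        by rewrite subr_ge0 => /(_ t1); rewrite mul1r; nra.
      by have := z1 b; nra.
    - by under eq_bigr do rewrite mul0r mulr0 addr0; exact: z1.
  by have := zmin _ zt; rewrite qp_cost_perturb; lra.
have [nu Hnu] := choice H.
by exists z, nu; split=> [//|b|i b|i b|b]; case: (Hnu b).
Qed.

End KKT.

(** * Clusters of vectors *)

Section Dot.
Context {R : realFieldType} {d : nat}.
Implicit Types u v w : 'rV[R]_d.

Definition dot u v : R := \sum_k u 0 k * v 0 k.

Lemma dotC u v : dot u v = dot v u.
Proof. by apply: eq_bigr => k _; rewrite mulrC. Qed.

Lemma dotDl u v w : dot (u + v) w = dot u w + dot v w.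
Proof. by rewrite -big_split; apply: eq_bigr => k _; rewrite mxE mulrDl. Qed.

Lemma dotZl a u w : dot (a *: u) w = a * dot u w.
Proof. by rewrite mulr_sumr; apply: eq_bigr => k _; rewrite mxE mulrA. Qed.

Lemma dotBl u v w : dot (u - v) w = dot u w - dot v w.
Proof. by rewrite dotDl -scaleN1r dotZl mulN1r. Qed.

Lemma dotDr u v w : dot w (u + v) = dot w u + dot w v.
Proof. by rewrite dotC dotDl !(dotC w). Qed.

Lemma dotBr u v w : dot w (u - v) = dot w u - dot w v.
Proof. by rewrite dotC dotBl !(dotC w). Qed.

Lemma dotZr a u w : dot w (a *: u) = a * dot w u.
Proof. by rewrite dotC dotZl dotC. Qed.

Lemma dot_suml (T : finType) (P : pred T) (u : T -> 'rV[R]_d) w :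
  dot (\sum_(t | P t) u t) w = \sum_(t | P t) dot (u t) w.
Proof.
rewrite exchange_big; apply: eq_bigr => k _ /=.
by rewrite summxE mulr_suml.
Qed.

Lemma dot_sumr (T : finType) (P : pred T) (u : T -> 'rV[R]_d) w :
  dot w (\sum_(t | P t) u t) = \sum_(t | P t) dot w (u t).
Proof. by rewrite dotC dot_suml; apply: eq_bigr => t _; rewrite dotC. Qed.

Lemma dot_ge0 u : 0 <= dot u u.
Proof. by apply: sumr_ge0 => k _; rewrite -expr2 sqr_ge0. Qed.

Lemma dot_young u v (a : R) : 0 < a ->
  - (dot u u / a) <= 2 * dot u v + a * dot v v.
Proof.
move=> a0; have := dot_ge0 (a^-1 *: u + v).
rewrite dotDl !dotDr !dotZl !dotZr (dotC v u) => H.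
have := mulr_ge0 (ltW a0) H.
have -> : a * (a^-1 * (a^-1 * dot u u) + a^-1 * dot u v + (a^-1 * dot u v + dot v v)) =
   dot u u / a + 2 * dot u v + a * dot v v by field; rewrite gt_eqF.
lra.
Qed.

Lemma dot_lincomb_le (T : finType) (a : T -> R) (u : T -> 'rV[R]_d) :
  dot (\sum_t a t *: u t) (\sum_t a t *: u t) <=
  (\sum_t a t ^+ 2) * \sum_t dot (u t) (u t).
Proof.
rewrite exchange_big mulr_sumr; apply: ler_sum => k _ /=.
rewrite -expr2 summxE; under [X in X ^+ _]eq_bigr do rewrite mxE.
apply: le_trans (cauchy_schwarz_sum _ _) _.
by under [X in _ * X]eq_bigr do rewrite expr2.
Qed.
End Dot.

(** Each off-diagonal term is at least minus the mean of the two squares. Summing this over all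
    pairs charges the diagonal as well, whence the [+ 1]. *)
Lemma diag_dominant (R : realFieldType) m (Q : 'I_m -> 'I_m -> R) (alpha : R)
    (s : 'I_m -> R) : (forall b, Q b b = alpha) ->
    (forall b c, b != c -> `|Q b c| <= 1) ->
  (alpha + 1 - m%:R) * \sum_b s b ^+ 2 <= \sum_b \sum_c Q b c * s b * s c.
Proof.
move=> Qd Qo.
apply: (@le_trans _ _ (\sum_b \sum_c ((c == b)%:R * (alpha + 1) * s b ^+ 2
    - (s b ^+ 2 + s c ^+ 2) / 2))).
  have -> : \sum_b \sum_c ((c == b)%:R * (alpha + 1) * s b ^+ 2 - (s b ^+ 2 + s c ^+ 2) / 2)
     = \sum_b ((alpha + 1) * s b ^+ 2 - (m%:R * s b ^+ 2 + \sum_c s c ^+ 2) / 2).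
    apply: eq_bigr => b _; rewrite big_split /= (bigD1 b) //= eqxx mul1r.
    rewrite big1 ?addr0 => [|c /negPf ->]; last by rewrite !mul0r.
    congr (_ + _); rewrite sumrN -mulr_suml big_split /= sumr_const card_ord.
    by rewrite mulr_natl.
  rewrite sumrB -mulr_sumr -mulr_suml big_split /= -mulr_sumr sumr_const card_ord.
  by rewrite -[X in (_ + X) / 2]mulr_natl; move: (\sum_b _) => t; lra.
apply: ler_sum => b _; apply: ler_sum => c _.
have [->|cb] := eqVneq c b; first by rewrite Qd mul1r; lra.
rewrite mul0r mul0r add0r; have := Qo b c; rewrite eq_sym => /(_ cb).
rewrite ler_norml => /andP[q1 q2].
have := sqr_ge0 (s b + s c); have := sqr_ge0 (s b - s c); nra.
Qed.

Lemma diag_dominant_dot (R : realFieldType) m d (Q : 'I_m -> 'I_m -> R) (alpha : R)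
    (y : 'I_m -> 'rV[R]_d) : (forall b, Q b b = alpha) ->
    (forall b c, b != c -> `|Q b c| <= 1) ->
  (alpha + 1 - m%:R) * \sum_b dot (y b) (y b) <= \sum_b \sum_c Q b c * dot (y b) (y c).
Proof.
move=> Qd Qo.
have -> : \sum_b \sum_c Q b c * dot (y b) (y c) =
    \sum_k \sum_b \sum_c Q b c * y b 0 k * y c 0 k.
  rewrite [RHS]exchange_big; apply: eq_bigr => b _ /=; rewrite [RHS]exchange_big.
  apply: eq_bigr => c _ /=; rewrite mulr_sumr.
  by apply: eq_bigr => k _; rewrite mulrA.
rewrite exchange_big mulr_sumr; apply: ler_sum => k _.
apply: le_trans (diag_dominant (fun b => y b 0 k) Qd Qo).
by under eq_bigr do rewrite -expr2.
Qed.

Section Clusters.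
Context {R : realType} {n r d : nat}.
Variable cl : 'I_n -> 'I_r.
Variable x : 'I_n -> 'rV[R]_d.

Definition clsize i : R := \sum_(a | cl a == i) 1.
Definition centroid i : 'rV[R]_d := (clsize i)^-1 *: \sum_(a | cl a == i) x a.
Definition deviation a : 'rV[R]_d := x a - centroid (cl a).
(** The deficits and the overlaps of distinct communities make up the defect; when all inner
    products lie between 0 and 1, it vanishes only for the block matrix of ones. *)
Definition deficit i : R := \sum_(a | cl a == i) \sum_(b | cl b == i) (1 - dot (x a) (x b)).
Definition overlap i j : R := \sum_(a | cl a == i) \sum_(b | cl b == j) dot (x a) (x b).

Hypothesis x01 : forall a b, 0 <= dot (x a) (x b) <= 1.
Hypothesis clsize_gt0 : forall i, 0 < clsize i.

Let x0 a b : 0 <= dot (x a) (x b). Proof. by case/andP: (x01 a b). Qed.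
Let x1 a b : dot (x a) (x b) <= 1. Proof. by case/andP: (x01 a b). Qed.

Lemma deficit_ge0 i : 0 <= deficit i.
Proof. by apply: sumr_ge0 => a _; apply: sumr_ge0 => b _; rewrite subr_ge0. Qed.

Lemma overlap_ge0 i j : 0 <= overlap i j.
Proof. by apply: sumr_ge0 => a _; apply: sumr_ge0. Qed.

Lemma overlap_diag i : overlap i i = clsize i ^+ 2 - deficit i.
Proof.
rewrite /overlap /deficit expr2 {1}/clsize mulr_suml -sumrB; apply: eq_bigr => a _.
rewrite mul1r /clsize -sumrB; apply: eq_bigr => b _; lra.
Qed.

Lemma dot_centroidr v i :
  dot v (centroid i) = (\sum_(b | cl b == i) dot v (x b)) / clsize i.
Proof. by rewrite dotZr dot_sumr mulrC. Qed.

Lemma dot_centroid i j :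
  dot (centroid i) (centroid j) = overlap i j / (clsize i * clsize j).
Proof.
rewrite dot_centroidr (eq_bigr (fun b => (\sum_(a | cl a == i) dot (x a) (x b)) / clsize i)).
  by rewrite -mulr_suml -mulrA -invfM exchange_big.
move=> b _; rewrite dotC dot_centroidr; congr (_ / _).
by apply: eq_bigr => a _; rewrite dotC.
Qed.

Lemma dot_centroid_diag i : dot (centroid i) (centroid i) = 1 - deficit i / clsize i ^+ 2.
Proof.
rewrite dot_centroid overlap_diag -expr2 mulrBl divff // expf_neq0 //.
by rewrite gt_eqF.
Qed.

(** The left side is the sum of the squared norms of the [x a], at most [clsize i], minus [clsize i]
    times the squared norm of the centroid, known from [dot_centroid_diag]. *)
Lemma deviation_norm i :
  \sum_(a | cl a == i) dot (deviation a) (deviation a) <= deficit i / clsize i.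
Proof.
apply: (@le_trans _ _ (\sum_(a | cl a == i) (1 - 2 * dot (x a) (centroid i)
    + dot (centroid i) (centroid i)))).
  apply: ler_sum => a /eqP ca; rewrite /deviation ca dotBl !dotBr (dotC (centroid i)).
  have := x1 a a; lra.
rewrite big_split sumrB /= -mulr_sumr -/(clsize i).
have -> : \sum_(a | cl a == i) dot (x a) (centroid i) = overlap i i / clsize i.
  by under eq_bigr do rewrite dot_centroidr; rewrite -mulr_suml.
have -> : \sum_(a | cl a == i) dot (centroid i) (centroid i) =
    clsize i * dot (centroid i) (centroid i).
  by rewrite /clsize mulr_suml; apply: eq_bigr => a _; rewrite mul1r.
rewrite dot_centroid overlap_diag le_eqVlt; apply/orP; left; apply/eqP; field.
by rewrite gt_eqF.
Qed.

Lemma deviation_total : \sum_a dot (deviation a) (deviation a) <=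
  \sum_i deficit i / clsize i.
Proof.
rewrite (partition_big cl xpredT) //=; apply: ler_sum => i _; exact: deviation_norm.
Qed.

(** Before centring, the terms [1 - dot (x a) (centroid i)], or [dot (x a) (centroid j)] for [j]
    distinct from [i], are nonnegative and add up to the fraction on the right; subtracting their
    mean at most doubles the sum of absolute values. *)
Lemma dot_deviation i j :
  \sum_(a | cl a == i) `|dot (deviation a) (centroid j)| <=
  2 * (if i == j then deficit i / clsize i else overlap i j / clsize j).
Proof.
have li := clsize_gt0 i; have lj := clsize_gt0 j.
have dE a : cl a == i -> dot (deviation a) (centroid j) =
    dot (x a) (centroid j) - overlap i j / (clsize i * clsize j).
  by move=> /eqP ca; rewrite /deviation ca dotBl dot_centroid.
have constE (c : R) : \sum_(a | cl a == i) c = clsize i * c.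
  by rewrite /clsize mulr_suml; apply: eq_bigr => a _; rewrite mul1r.
have sE : \sum_(a | cl a == i) dot (x a) (centroid j) = overlap i j / clsize j.
  by under eq_bigr do rewrite dot_centroidr; rewrite -mulr_suml.
have c0 a : 0 <= dot (x a) (centroid j).
  by rewrite dot_centroidr; apply: divr_ge0; [exact: sumr_ge0|exact: ltW].
have [ij|ij] := eqVneq i j.
  subst j; apply: (@le_trans _ _ (\sum_(a | cl a == i)
     ((1 - dot (x a) (centroid i)) + deficit i / clsize i ^+ 2))).
    apply: ler_sum => a ai;
      rewrite dE // overlap_diag -expr2 mulrBl divff ?expf_neq0 ?gt_eqF //.
    have : 0 <= 1 - dot (x a) (centroid i).
      rewrite dot_centroidr subr_ge0 ler_pdivrMr // mul1r; exact: ler_sum.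
    have : 0 <= deficit i / clsize i ^+ 2.
      by apply: divr_ge0; [exact: deficit_ge0|exact/exprn_ge0/ltW].
    by move=> *; rewrite ler_norml; lra.
  rewrite big_split sumrB !constE sE overlap_diag /=.
  rewrite le_eqVlt; apply/orP; left; apply/eqP; field; by rewrite gt_eqF.
apply: (@le_trans _ _ (\sum_(a | cl a == i)
     (dot (x a) (centroid j) + overlap i j / (clsize i * clsize j)))).
  apply: ler_sum => a ai; rewrite dE //; apply: le_trans (ler_normB _ _) _.
  rewrite !ger0_norm // divr_ge0 ?overlap_ge0 //; exact/ltW/mulr_gt0.
rewrite big_split constE sE /= le_eqVlt; apply/orP; left; apply/eqP; field.
by rewrite !gt_eqF.
Qed.

End Clusters.

(** * The cost of the outliers *)

Section Outliers.
Context {R : realType} {n r m d : nat}.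
Variable cl : 'I_n -> 'I_r.
Variables (x : 'I_n -> 'rV[R]_d) (w : 'I_m -> 'rV[R]_d).
Variables (Z : 'I_n -> 'I_m -> R) (Q : 'I_m -> 'I_m -> R).
Variables (alpha lambda p nmin rho : R).

Let E a b := lambda - Z a b.
Let e i b := \sum_(a | cl a == i) E a b.
Local Notation l := (@clsize R n r cl).
Local Notation u := (centroid cl x).
Local Notation dev := (deviation cl x).
Let S := deficit cl x.
Let O := overlap cl x.

Hypothesis x01 : forall a b, 0 <= dot (x a) (x b) <= 1.
Hypothesis xw0 : forall a b, 0 <= dot (x a) (w b).
Hypothesis w1 : forall b, dot (w b) (w b) <= 1.
Hypothesis Z01 : forall a b, Z a b = 0 \/ Z a b = 1.
Hypothesis Q_sym : forall b c, Q b c = Q c b.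
Hypothesis Q_diag : forall b, Q b b = alpha.
Hypothesis Q_off : forall b c, b != c -> `|Q b c| <= 1.
Hypothesis lambda01 : 0 <= lambda <= 1.
Hypothesis lambda_p : lambda <= p.
Hypothesis alpha_ge : 3 * m%:R <= alpha.
Hypothesis nmin_gt0 : 0 < nmin.
Hypothesis nmin_le : forall i, nmin <= l i.
Hypothesis m_nmin : m%:R <= nmin.
Hypothesis rho_ge0 : 0 <= rho.
Hypothesis rho2 : rho ^+ 2 = r%:R.

Let l_gt0 i : 0 < l i. Proof. exact: lt_le_trans (nmin_le i). Qed.

Variables (z : 'I_r -> 'I_m -> R) (nu : 'I_m -> R).
Hypothesis z_ball : quarter_ball z.
Hypothesis nu_ge0 : forall b, 0 <= nu b.
Let phi i b := qp_grad e Q z i b + nu b * z i b.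
Hypothesis phi_ge0 : forall i b, 0 <= phi i b.
Hypothesis phi_z : forall i b, phi i b * z i b = 0.
Hypothesis nu_z : forall b, nu b * \sum_i z i b ^+ 2 = nu b.

Let z0 i b : 0 <= z i b. Proof. by case: z_ball. Qed.
Let z1 i b : z i b <= 1.
Proof.
rewrite -(@ler_pXn2r _ 2) ?nnegrE // expr1n; case: z_ball => _ /(_ b).
apply: le_trans; rewrite (bigD1 i) //= lerDl; apply: sumr_ge0 => j _; exact: sqr_ge0.
Qed.

(** [q] and [y] split [w], and [h b] is the force on outlier [b] that remains when each [x a] is
    replaced by its deviation. By [qpsiE], [qpsi] is [Q] plus the diagonal of [nu], applied to
    [z]. *)
Let q b := \sum_i z i b *: u i.
Let y b := w b - q b.
Let h b := \sum_a E a b *: dev a.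
Let qpsi i b := phi i b - e i b.

Lemma qpsiE i b : qpsi i b = \sum_c Q b c * z i c + nu b * z i b.
Proof. by rewrite /qpsi /phi /qp_grad; ring. Qed.

(** Adding the [nu] terms turns [Q] into [Q] plus the diagonal of [nu], whose pairing of [q] with
    any vectors is given by [qpsi]. The cross terms between [q] and [y] then cancel against the
    [qpsi] part of [e = phi - qpsi]. *)
Lemma outlier_expand :
  2 * (\sum_a \sum_b E a b * dot (x a) (w b)) + (\sum_b \sum_c Q b c * dot (w b) (w c))
   + \sum_b nu b * dot (w b) (w b) =
  \sum_b 2 * dot (h b) (w b) + ((\sum_b \sum_c Q b c * dot (y b) (y c)) +
   \sum_b nu b * dot (y b) (y b)) + 2 * (\sum_i \sum_b phi i b * dot (u i) (w b))
   - \sum_i \sum_b qpsi i b * dot (u i) (q b).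
Proof.
have s1 : \sum_a \sum_b E a b * dot (x a) (w b) =
    \sum_b dot (h b) (w b) + \sum_i \sum_b e i b * dot (u i) (w b).
  rewrite exchange_big [X in _ = _ + X]exchange_big -big_split; apply: eq_bigr => b _ /=.
  rewrite dot_suml [X in _ + X](_ : _ = \sum_a E a b * dot (u (cl a)) (w b)).
    by rewrite -big_split; apply: eq_bigr => a _; rewrite /= (dotZl (E a b)) dotBl; ring.
  rewrite [RHS](partition_big cl xpredT) //=; apply: eq_bigr => i _.
  by rewrite /e mulr_suml; apply: eq_bigr => a /eqP ->.
have qv v : \sum_b \sum_c Q b c * dot (q c) (v b) + \sum_b nu b * dot (q b) (v b) =
    \sum_i \sum_b qpsi i b * dot (u i) (v b).
  rewrite [RHS]exchange_big -big_split; apply: eq_bigr => b _ /=.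
  have -> : \sum_c Q b c * dot (q c) (v b) =
      \sum_i (\sum_c Q b c * z i c) * dot (u i) (v b).
    under [RHS]eq_bigr do rewrite mulr_suml.
    rewrite [RHS]exchange_big; apply: eq_bigr => c _ /=; rewrite dot_suml mulr_sumr.
    by apply: eq_bigr => i _; rewrite (dotZl (z i c)) mulrA.
  rewrite dot_suml mulr_sumr -big_split; apply: eq_bigr => i _ /=.
  by rewrite (dotZl (z i b)) qpsiE; ring.
have ww b c : dot (w b) (w c) = dot (y b) (y c) + dot (q b) (y c) + dot (q c) (y b)
     + dot (q c) (q b).
  rewrite /y !dotBl !dotBr (dotC (q b) (w c)) (dotC (w b) (q c)) (dotC (q c) (w b)).
  by rewrite (dotC (w b) (q c)) (dotC (q b) (q c)); ring.
have sw : \sum_b \sum_c Q b c * dot (q b) (y c) = \sum_b \sum_c Q b c * dot (q c) (y b).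
  by rewrite exchange_big; apply: eq_bigr => b _; apply: eq_bigr => c _; rewrite Q_sym.
have Qww : \sum_b \sum_c Q b c * dot (w b) (w c) = \sum_b \sum_c Q b c * dot (y b) (y c)
   + 2 * (\sum_b \sum_c Q b c * dot (q c) (y b)) + \sum_b \sum_c Q b c * dot (q c) (q b).
  rewrite mulr_natl mulr2n -{1}sw -!big_split; apply: eq_bigr => b _ /=.
  by rewrite -!big_split; apply: eq_bigr => c _ /=; rewrite ww; ring.
have nww : \sum_b nu b * dot (w b) (w b) = \sum_b nu b * dot (y b) (y b)
   + 2 * (\sum_b nu b * dot (q b) (y b)) + \sum_b nu b * dot (q b) (q b).
  rewrite mulr_natl mulr2n -!big_split; apply: eq_bigr => b _ /=.
  by rewrite ww; ring.
have uy : \sum_i \sum_b qpsi i b * dot (u i) (y b) =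
    \sum_i \sum_b qpsi i b * dot (u i) (w b) - \sum_i \sum_b qpsi i b * dot (u i) (q b).
  rewrite -sumrB; apply: eq_bigr => i _; rewrite -sumrB; apply: eq_bigr => b _.
  by rewrite dotBr mulrBr.
have ew : \sum_i \sum_b e i b * dot (u i) (w b) =
    \sum_i \sum_b phi i b * dot (u i) (w b) - \sum_i \sum_b qpsi i b * dot (u i) (w b).
  rewrite -sumrB; apply: eq_bigr => i _; rewrite -sumrB; apply: eq_bigr => b _.
  by rewrite /qpsi; ring.
rewrite s1 Qww nww -mulr_sumr ew.
have := qv y; have := qv q; rewrite uy.
move: (\sum_i \sum_b _ * dot (u i) (q b)) (\sum_i \sum_b qpsi i b * dot (u i) (w b)).
move=> t1 t2 H1 H2; lra.
Qed.

(** If [z i b = 0], the diagonal of [Q] and [nu] drop out and at most [m <= l i] remains. Otherwise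
    [phi i b = 0] by complementary slackness, and [qpsi] is minus a sum of [l i] terms
    [E a b >= -1]. *)
Lemma qpsi_le i b : qpsi i b <= l i.
Proof.
have [zib|zib] := eqVneq (z i b) 0.
  rewrite qpsiE zib mulr0 addr0; apply: le_trans (le_trans m_nmin (nmin_le i)).
  apply: (@le_trans _ _ (\sum_(c < m) 1)); last by rewrite sumr_const card_ord.
  apply: ler_sum => c _; have [->|cb] := eqVneq c b; first by rewrite zib mulr0.
  have := @Q_off b c; rewrite eq_sym => /(_ cb); rewrite ler_norml => /andP[_ q1].
  by have := z0 i c; have := z1 i c; nra.
have /eqP := phi_z i b; rewrite mulf_eq0 (negPf zib) orbF => /eqP ph.
rewrite /qpsi ph sub0r -sumrN; apply: ler_sum => a _; rewrite /E.
by case/andP: lambda01 => ? ?; case: (Z01 a b) => ->; lra.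
Qed.

Let T i j := \sum_b qpsi i b * z j b.

Lemma qpsi_pair_le i j : T i j <= m%:R * l i.
Proof.
apply: (@le_trans _ _ (\sum_(b < m) l i)); last by rewrite sumr_const card_ord mulr_natl.
apply: ler_sum => b _; apply: (@le_trans _ _ (l i * z j b)).
  by rewrite ler_wpM2r // qpsi_le.
by rewrite ler_piMr // ltW.
Qed.

Let kappa_gt0 b : 0 < alpha - 2 * m%:R + nu b.
Proof.
(* An outlier [b] exists, so [m >= 1] and [alpha - 2 * m >= m] is positive. *)
have : (1 : R) <= m%:R by rewrite ler1n (leq_ltn_trans _ (ltn_ord b)).
have := nu_ge0 b; move: alpha_ge; lra.
Qed.

Lemma qpsi_pair_diag_ge0 i : 0 <= T i i.
Proof.
have -> : T i i = \sum_b \sum_c Q b c * z i b * z i c + \sum_b nu b * z i b ^+ 2.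
  rewrite -big_split; apply: eq_bigr => b _ /=; rewrite qpsiE mulrDl mulr_suml.
  by congr (_ + _); [apply: eq_bigr => c _; ring | ring].
apply: addr_ge0; last by apply: sumr_ge0 => b _; apply: mulr_ge0 => //; exact: sqr_ge0.
apply: le_trans (diag_dominant (z i) Q_diag Q_off); apply: mulr_ge0.
  by have := ler0n R m; move: alpha_ge; lra.
by apply: sumr_ge0 => b _; exact: sqr_ge0.
Qed.

(** Complementary slackness turns the sum of the [e i b * z i b] into minus the sum of the [T i i],
    and [nu_z] makes the [nu] part of the latter equal to the sum of [nu]. *)
Lemma qp_costE : qp_cost e Q z + \sum_b nu b = - \sum_i T i i.
Proof.
have -> : \sum_b nu b = \sum_i \sum_b nu b * z i b ^+ 2.
  rewrite exchange_big; apply: eq_bigr => b _ /=; by rewrite -mulr_sumr nu_z.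
rewrite /qp_cost mulr_sumr -!big_split -sumrN; apply: eq_bigr => i _ /=.
rewrite mulr_sumr -!big_split -sumrN; apply: eq_bigr => b _ /=.
have := phi_z i b; rewrite /qpsi.
have -> : \sum_c Q b c * z i b * z i c = (\sum_c Q b c * z i c) * z i b.
  by rewrite mulr_suml; apply: eq_bigr => c _; ring.
rewrite /phi /qp_grad; lra.
Qed.

Let off := \sum_i \sum_(j | j != i) O i j.

(** Expanding [q] weights [T i j] by [dot (u i) (u j)]. On the diagonal the weight is at most 1 and
    [T i i >= 0]; off the diagonal it is [O i j / (l i * l j)], against [T i j <= m * l i]. *)
Lemma qpsi_pair_compare : - (m%:R / nmin * off) <=
  (\sum_i T i i) - \sum_i \sum_b qpsi i b * dot (u i) (q b).
Proof.
have -> : \sum_i \sum_b qpsi i b * dot (u i) (q b) =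
    \sum_i \sum_j dot (u i) (u j) * T i j.
  apply: eq_bigr => i _; under [RHS]eq_bigr do rewrite mulr_sumr.
  rewrite exchange_big; apply: eq_bigr => b _ /=; rewrite dot_sumr mulr_sumr.
  by apply: eq_bigr => j _; rewrite (dotZr (z j b)); ring.
rewrite -sumrB /off mulr_sumr -sumrN; apply: ler_sum => i _.
rewrite [in leRHS](bigD1 i) //= mulr_sumr.
have g1 : dot (u i) (u i) * T i i <= T i i.
  rewrite ler_piMl ?qpsi_pair_diag_ge0 // dot_centroid_diag // gerBl; apply: divr_ge0.
    exact: deficit_ge0.
  exact/exprn_ge0/ltW.
suff : \sum_(j | j != i) dot (u i) (u j) * T i j <= \sum_(j | j != i) m%:R / nmin * O i j.
  by lra.
apply: ler_sum => j _; rewrite dot_centroid.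
have O0 : 0 <= O i j by exact: overlap_ge0.
apply: (@le_trans _ _ (O i j / (l i * l j) * (m%:R * l i))).
  by rewrite ler_wpM2l ?qpsi_pair_le // divr_ge0 // mulr_ge0 // ltW.
have -> : O i j / (l i * l j) * (m%:R * l i) = m%:R * O i j / l j.
  by field; rewrite !gt_eqF.
rewrite [leRHS]mulrAC; apply: ler_wpM2l; first exact: mulr_ge0.
by rewrite lef_pV2 ?posrE.
Qed.

(** By Cauchy-Schwarz the squared norm of [h b] is at most [lambda * n + deg] times the total
    deviation. A large degree is harmless: [phi >= 0] then forces a large [nu b], which stands in
    the denominator. *)
Lemma pull_norm_le b : dot (h b) (h b) / (alpha - 2 * m%:R + nu b) <=
  (\sum_i S i) / nmin * (2 * (p * n%:R) / (alpha - 2 * m%:R) + 4 * rho).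
Proof.
have m1 : (1 : R) <= m%:R by rewrite ler1n (leq_ltn_trans _ (ltn_ord b)).
have age := alpha_ge.
pose deg := \sum_a Z a b.
have E2 : \sum_a E a b ^+ 2 <= lambda * n%:R + deg.
  have -> : lambda * n%:R + deg = \sum_a (lambda + Z a b).
    by rewrite big_split /= sumr_const card_ord mulr_natr.
  apply: ler_sum => a _; rewrite /E; case/andP: lambda01 => ? ?.
  by case: (Z01 a b) => ->; nra.
have zrho c : \sum_i z i c <= rho.
  rewrite -(@ler_pXn2r _ 2) ?nnegrE // ?sumr_ge0 // rho2.
  have := cauchy_schwarz_sum (fun i => z i c) (fun=> 1).
  under eq_bigr do rewrite mulr1; move/le_trans; apply.
  rewrite (_ : \sum_i 1 ^+ 2 = r%:R); last first.
    by under eq_bigr do rewrite expr1n; rewrite sumr_const card_ord.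
  by rewrite ler_piMl //; case: z_ball.
(* Sum [phi i b >= 0] over [i]; each column of [z] has l1 norm at most [rho]. *)
have degle : deg <= lambda * n%:R + rho * (alpha + m%:R + nu b).
  have esum : \sum_i e i b = lambda * n%:R - deg.
    transitivity (\sum_a E a b); first by rewrite [RHS](partition_big cl xpredT).
    by rewrite sumrB sumr_const card_ord mulr_natr.
  have : 0 <= \sum_i phi i b by exact: sumr_ge0.
  rewrite /phi /qp_grad !big_split /= esum -mulr_sumr.
  have Qz : \sum_i \sum_c Q b c * z i c <= alpha * rho + m%:R * rho.
    rewrite exchange_big /=.
    apply: (@le_trans _ _ (\sum_c ((c == b)%:R * alpha * \sum_i z i c + \sum_i z i c))).
      apply: ler_sum => c _; rewrite -mulr_sumr.
      have zs0 c' : 0 <= \sum_i z i c' by apply: sumr_ge0.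
      have [->|cb] := eqVneq c b; first by rewrite Q_diag mul1r lerDl.
      have := @Q_off b c; rewrite eq_sym => /(_ cb); rewrite ler_norml => /andP[_ q1].
      by rewrite !mul0r add0r ler_piMl.
    rewrite big_split /=; apply: lerD.
      rewrite (bigD1 b) //= eqxx mul1r [X in _ + X]big1 => [|c /negPf cb];
        last by rewrite cb !mul0r.
      by rewrite addr0 ler_wpM2l //; lra.
    rewrite mulr_natl -[X in _ <= _ *+ X]card_ord -sumr_const; exact: ler_sum.
  have : nu b * \sum_i z i b <= nu b * rho by rewrite ler_wpM2l.
  lra.
have [l0 l1] := andP lambda01.
have n0 := ler0n R n.
have k0 : 0 < alpha - 2 * m%:R by lra.
have kb := kappa_gt0 b.
have S0 : 0 <= (\sum_i S i) / nmin.
  by apply: divr_ge0; [apply: sumr_ge0 => i _; exact: deficit_ge0|exact: ltW].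
have dev_le : \sum_a dot (dev a) (dev a) <= (\sum_i S i) / nmin.
  apply: le_trans (deviation_total x01 l_gt0) _; rewrite mulr_suml.
  apply: ler_sum => i _; rewrite ler_wpM2l ?deficit_ge0 // lef_pV2 ?posrE //.
have E20 : 0 <= \sum_a E a b ^+ 2 by apply: sumr_ge0 => a _; exact: sqr_ge0.
rewrite ler_pdivrMr //; apply: le_trans (dot_lincomb_le _ _) _.
apply: (@le_trans _ _ ((\sum_a E a b ^+ 2) * ((\sum_i S i) / nmin))).
  by rewrite ler_wpM2l.
rewrite [leLHS]mulrC -[leRHS]mulrA ler_wpM2l //.
(* The factor 4 suffices since [alpha + m + nu b <= 4 * (alpha - 2 * m + nu b)] amounts to
   [3 * m <= alpha + nu b]. *)
apply: (@le_trans _ _ (2 * (p * n%:R) + rho * (4 * (alpha - 2 * m%:R + nu b)))).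
  apply: (@le_trans _ _ (2 * (p * n%:R) + rho * (alpha + m%:R + nu b))).
    have : lambda * n%:R <= p * n%:R by rewrite ler_wpM2r.
    by lra.
  rewrite lerD2l ler_wpM2l //; have := nu_ge0 b; lra.
rewrite [leRHS]mulrDl; apply: lerD; last by rewrite mulrA [4 * rho]mulrC.
rewrite -[leRHS]mulrA ler_peMr //; first by rewrite !mulr_ge0 //; exact: le_trans lambda_p.
by rewrite mulrC ler_pdivlMr // mul1r lerDl.
Qed.

Lemma pull_dot_combination_ge b : - (2 * ((\sum_i S i) / nmin + off / nmin)) <= dot (h b) (q b).
Proof.
rewrite lerNl dot_sumr -sumrN.
have inv_le i : (l i)^-1 <= nmin^-1 by rewrite lef_pV2 ?posrE.
have [l0 l1] := andP lambda01.
have -> : 2 * ((\sum_i S i) / nmin + off / nmin) =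
    \sum_j \sum_i 2 * ((if i == j then S i else O i j) / nmin).
  rewrite [RHS]exchange_big -mulrDl /off -big_split /= mulr_suml mulr_sumr.
  apply: eq_bigr => i _; rewrite [RHS](bigD1 i) //= eqxx (mulrDl (S i)) mulrDr.
  congr (_ + _).
  rewrite mulr_suml mulr_sumr; apply: eq_bigr => j /negPf ji.
  by rewrite eq_sym ji.
apply: ler_sum => j _.
apply: (@le_trans _ _ (\sum_a `|dot (dev a) (u j)|)).
  rewrite (dotZr (z j b)) dot_suml mulr_sumr -sumrN; apply: ler_sum => a _.
  rewrite (dotZl (E a b)); apply: le_trans (ler_norm _) _; rewrite normrN !normrM mulrA.
  rewrite ler_piMl // (ger0_norm (z0 j b)) mulr_ile1 // /E ler_norml.
  by case: (Z01 a b) => ->; lra.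
rewrite (partition_big cl xpredT) //=; apply: ler_sum => i _.
apply: le_trans (dot_deviation x01 l_gt0 i j) _; rewrite ler_wpM2l //.
case: ifP => _; rewrite ler_wpM2l ?deficit_ge0 ?overlap_ge0 //.
Qed.

(** In [outlier_expand] the [phi] term is nonnegative, and [dot (w b) (w b) <= 1] brings in
    [qp_costE]. Each [h b] meets [y b] through Young's inequality with curvature
    [alpha - 2 * m + nu b], and [q b] through [pull_dot_combination_ge]. The factor 5 is 4 from the
    latter plus 1 that covers [qpsi_pair_compare]. *)
Lemma outlier_cost_ge :
  qp_cost e Q z - (5 * m%:R / nmin * (\sum_i S i + off) +
     m%:R * ((\sum_i S i) / nmin * (2 * (p * n%:R) / (alpha - 2 * m%:R) + 4 * rho))) <=
  2 * (\sum_a \sum_b E a b * dot (x a) (w b)) + \sum_b \sum_c Q b c * dot (w b) (w c).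
Proof.
have expd := outlier_expand.
have cmp := qpsi_pair_compare.
have cst := qp_costE.
have off0 : 0 <= off.
  by apply: sumr_ge0 => i _; apply: sumr_ge0 => j _; exact: overlap_ge0.
have S0 : 0 <= \sum_i S i by apply: sumr_ge0 => i _; exact: deficit_ge0.
have nw : \sum_b nu b * dot (w b) (w b) <= \sum_b nu b.
  by apply: ler_sum => b _; rewrite ler_piMr.
have uw : 0 <= \sum_i \sum_b phi i b * dot (u i) (w b).
  apply: sumr_ge0 => i _; apply: sumr_ge0 => b _; apply: mulr_ge0 => //.
  rewrite dotC dot_centroidr; apply: divr_ge0; last exact: ltW.
  by apply: sumr_ge0 => a _; rewrite dotC.
pose hb := (\sum_i S i) / nmin * (2 * (p * n%:R) / (alpha - 2 * m%:R) + 4 * rho).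
have hy : - (m%:R * hb) + - (m%:R * (4 * ((\sum_i S i) / nmin + off / nmin))) <=
   \sum_b 2 * dot (h b) (w b) + ((\sum_b \sum_c Q b c * dot (y b) (y c)) +
   \sum_b nu b * dot (y b) (y b)).
  apply: (@le_trans _ _ (\sum_b (2 * dot (h b) (w b) +
      (alpha - 2 * m%:R + nu b) * dot (y b) (y b)))); last first.
    rewrite big_split /= lerD2l; under eq_bigr do rewrite mulrDl.
    rewrite big_split lerD2r /=; apply: le_trans (diag_dominant_dot y Q_diag Q_off).
    rewrite mulr_sumr; apply: ler_sum => b _; apply: ler_wpM2r; first exact: dot_ge0.
    by have := ler0n R m; move: alpha_ge; lra.
  have -> : - (m%:R * hb) + - (m%:R * (4 * ((\sum_i S i) / nmin + off / nmin))) =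
      \sum_(b < m) (- hb - 4 * ((\sum_i S i) / nmin + off / nmin)).
    by rewrite sumr_const card_ord -[RHS]mulr_natl; ring.
  apply: ler_sum => b _.
  have -> : dot (h b) (w b) = dot (h b) (y b) + dot (h b) (q b) by rewrite dotBr subrK.
  have := dot_young (h b) (y b) (kappa_gt0 b).
  have := pull_norm_le b; have := pull_dot_combination_ge b; rewrite -/hb; lra.
rewrite -/hb.
have -> : 5 * m%:R / nmin * (\sum_i S i + off) =
   m%:R * (4 * ((\sum_i S i) / nmin + off / nmin)) + m%:R / nmin * off +
   m%:R / nmin * \sum_i S i by field; rewrite gt_eqF.
have : 0 <= m%:R / nmin * \sum_i S i by rewrite mulr_ge0 // divr_ge0 // ltW.
lra.
Qed.

End Outliers.

(** * The cost of the inliers *)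

Section Inliers.
Context {R : realType} {n r d : nat}.
Variable cl : 'I_n -> 'I_r.
Variable x : 'I_n -> 'rV[R]_d.
Variables (N : 'I_n -> 'I_n -> R) (B : 'I_r -> 'I_r -> R).
Variables (alpha lambda delta nmin : R).

Local Notation l := (@clsize R n r cl).
Local Notation u := (centroid cl x).
Local Notation dev := (deviation cl x).
Local Notation S := (deficit cl x).
Local Notation O := (overlap cl x).
Let beta i := B i i - lambda.

Hypothesis x01 : forall a b, 0 <= dot (x a) (x b) <= 1.
Hypothesis nmin_gt0 : 0 < nmin.
Hypothesis nmin_le : forall i, nmin <= l i.
Hypothesis delta_gt0 : 0 < delta.
Hypothesis beta_ge : forall i, delta / 4 <= B i i - lambda.
Hypothesis off_ge : forall i j, i != j -> delta / 4 <= lambda - B i j.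
Hypothesis lambda_ge0 : 0 <= lambda.
Hypothesis B_le1 : forall i j, B i j <= 1.
Hypothesis alpha_ge0 : 0 <= alpha.
Hypothesis N_sym : forall a b, N a b = N b a.

Let tau i j := (if i == j then beta j else delta) * l j / 64.

Hypothesis row_dev : forall a j, `|\sum_(b | cl b == j) N a b| <=
  (if cl a == j then B j j - lambda else delta) * l j / 64.
Hypothesis spec_diag : forall i (v : 'I_n -> R),
  \sum_a \sum_b ((cl a == i) && (cl b == i))%:R * N a b * v a * v b <=
  (B i i - lambda) * l i / 64 * \sum_a v a ^+ 2.
Hypothesis spec_off : forall v : 'I_n -> R,
  \sum_a \sum_b (cl a != cl b)%:R * N a b * v a * v b <=
  delta * nmin / 64 * \sum_a v a ^+ 2.

Let l_gt0 i : 0 < l i. Proof. exact: lt_le_trans (nmin_le i). Qed.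
Let beta_gt0 i : 0 < beta i.
Proof. by apply: lt_le_trans (beta_ge i); rewrite divr_gt0. Qed.
Let x0 a b : 0 <= dot (x a) (x b). Proof. by case/andP: (x01 a b). Qed.
Let x1 a b : dot (x a) (x b) <= 1. Proof. by case/andP: (x01 a b). Qed.

Let off := \sum_i \sum_(j | j != i) O i j.
Let bS := \sum_i beta i * S i.

Lemma sum_clusters (F : 'I_n -> 'I_n -> R) :
  \sum_a \sum_b F a b =
  \sum_i \sum_j \sum_(a | cl a == i) \sum_(b | cl b == j) F a b.
Proof.
rewrite (partition_big cl xpredT) //=; apply: eq_bigr => i _.
by rewrite [RHS]exchange_big; apply: eq_bigr => a _; rewrite [LHS](partition_big cl xpredT).
Qed.

(** Each coordinate of the deviations is a vector to which the spectral bounds apply, once [N] is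
    split into its diagonal blocks and the rest; [deviation_norm] trades squared norms for
    deficits. *)
Lemma noise_dev_le :
  \sum_a \sum_b N a b * dot (dev a) (dev b) <= (bS + delta * \sum_i S i) / 64.
Proof.
have -> : \sum_a \sum_b N a b * dot (dev a) (dev b) =
    \sum_k \sum_a \sum_b N a b * dev a 0 k * dev b 0 k.
  rewrite [RHS]exchange_big; apply: eq_bigr => a _ /=; rewrite [RHS]exchange_big.
  by apply: eq_bigr => b _ /=; rewrite mulr_sumr; apply: eq_bigr => k _; rewrite mulrA.
apply: (@le_trans _ _ (\sum_k (\sum_i (beta i * l i / 64 *
    \sum_(a | cl a == i) dev a 0 k ^+ 2) + delta * nmin / 64 * \sum_a dev a 0 k ^+ 2))).
  apply: ler_sum => k _; pose v a := dev a 0 k.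
  have -> : \sum_a \sum_b N a b * dev a 0 k * dev b 0 k =
      \sum_i (\sum_a \sum_b ((cl a == i) && (cl b == i))%:R * N a b *
         ((cl a == i)%:R * v a) * ((cl b == i)%:R * v b)) +
      \sum_a \sum_b (cl a != cl b)%:R * N a b * v a * v b.
    rewrite [X in _ = X + _]exchange_big -big_split; apply: eq_bigr => a _ /=.
    rewrite [X in _ = X + _]exchange_big -big_split; apply: eq_bigr => b _ /=.
    rewrite (bigD1 (cl a)) //= eqxx /= big1 ?addr0 => [|i]; last first.
      by rewrite eq_sym => /negPf ->; rewrite !mul0r.
    rewrite /v [cl b == cl a]eq_sym; case: eqP => _ /=; ring.
  apply: lerD; last exact: spec_off.
  apply: ler_sum => i _.
  apply: le_trans (spec_diag i (fun a => (cl a == i)%:R * v a)) _.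
  rewrite ler_wpM2l //; first by rewrite divr_ge0 // mulr_ge0 // ltW // beta_gt0.
  rewrite [leRHS]big_mkcond; apply: ler_sum => a _ /=.
  by case: ifP => _; rewrite ?mul1r ?mul0r ?expr0n.
have normE (P : pred 'I_n) : \sum_k \sum_(a | P a) dev a 0 k ^+ 2 =
    \sum_(a | P a) dot (dev a) (dev a).
  by rewrite exchange_big; apply: eq_bigr => a _; apply: eq_bigr => k _; rewrite expr2.
rewrite big_split exchange_big /= -mulr_sumr normE.
have S0 i : 0 <= S i by exact: deficit_ge0.
rewrite mulrDl /bS mulr_suml; apply: lerD.
  apply: ler_sum => i _; rewrite -mulr_sumr normE.
  apply: (@le_trans _ _ (beta i * l i / 64 * (S i / l i))).
    rewrite ler_wpM2l ?deviation_norm //.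
    by rewrite divr_ge0 // mulr_ge0 // ltW.
  rewrite le_eqVlt; apply/orP; left; apply/eqP; field; by rewrite gt_eqF.
apply: (@le_trans _ _ (delta * nmin / 64 * ((\sum_i S i) / nmin))); last first.
  by rewrite le_eqVlt; apply/orP; left; apply/eqP; field; rewrite gt_eqF.
rewrite ler_wpM2l //; first by rewrite divr_ge0 // mulr_ge0 // ltW.
apply: le_trans (deviation_total x01 l_gt0) _; rewrite mulr_suml.
by apply: ler_sum => i _; rewrite ler_wpM2l // lef_pV2 ?posrE.
Qed.

(** As [F] sees [a] only through its community, summing over [a] produces row sums of [N], bounded
    by [tau]. *)
Lemma noise_cluster_le (F : 'I_r -> 'I_n -> R) :
    (forall i j, \sum_(b | cl b == j) `|F i b| <=
      if j == i then S i / l i else O j i / l i) ->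
  `|\sum_a \sum_b N a b * F (cl a) b| <= (bS + delta * off) / 64.
Proof.
move=> HF.
have -> : \sum_a \sum_b N a b * F (cl a) b =
    \sum_j \sum_i \sum_(b | cl b == j) F i b * \sum_(a | cl a == i) N b a.
  rewrite sum_clusters exchange_big; apply: eq_bigr => j _; apply: eq_bigr => i _.
  rewrite exchange_big; apply: eq_bigr => b _ /=; rewrite mulr_sumr.
  by apply: eq_bigr => a /eqP ->; rewrite N_sym mulrC.
have -> : (bS + delta * off) / 64 =
    \sum_j \sum_i ((if j == i then S i / l i else O j i / l i) * tau j i).
  rewrite /bS /off mulr_sumr -big_split mulr_suml; apply: eq_bigr => i _ /=.
  rewrite [RHS](bigD1 i) //= /tau eqxx (mulrDl (beta i * S i)); congr (_ + _).
    by field; rewrite gt_eqF.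
  rewrite mulr_sumr mulr_suml; apply: eq_bigr => j; rewrite eq_sym => /negPf ->.
  by field; rewrite gt_eqF.
apply: le_trans (ler_norm_sum _ _ _) _; apply: ler_sum => j _.
apply: le_trans (ler_norm_sum _ _ _) _; apply: ler_sum => i _.
apply: le_trans (ler_norm_sum _ _ _) _.
have tau0 : 0 <= tau j i.
  rewrite /tau divr_ge0 // mulr_ge0 //; last exact: ltW.
  by case: ifP => _; exact: ltW.
apply: (@le_trans _ _ (\sum_(b | cl b == j) `|F i b| * tau j i)).
  apply: ler_sum => b /eqP bj; rewrite normrM ler_wpM2l //.
  by have := row_dev b i; rewrite bj.
by rewrite -mulr_suml ler_wpM2r.
Qed.

(** The error in [dot (x a) (x b)] is [dot (dev a) (dev b)], plus [F1] in both orders of the pair,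
    minus [F2]. These parts give the coefficients 4 = 1 + 2 + 1 and 3 = 2 + 1. *)
Lemma noise_total_le :
  \sum_a \sum_b N a b * (dot (x a) (x b) - (cl a == cl b)%:R) <=
  (4 * bS + delta * (\sum_i S i) + 3 * (delta * off)) / 64.
Proof.
pose F1 i b := dot (u i) (x b) - (i == cl b)%:R.
pose F2 i b := dot (u i) (u (cl b)) - (i == cl b)%:R.
have constE (c : R) i : \sum_(a | cl a == i) c = l i * c.
  by rewrite /clsize mulr_suml; apply: eq_bigr => a _; rewrite mul1r.
have ux0 i b : 0 <= dot (u i) (x b).
  rewrite dotC dot_centroidr; apply: divr_ge0; [exact: sumr_ge0|exact: ltW].
have ux1 i b : dot (u i) (x b) <= 1.
  by rewrite dotC dot_centroidr ler_pdivrMr // mul1r; exact: ler_sum.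
have uxE i j : \sum_(b | cl b == j) dot (u i) (x b) = O j i / l i.
  under eq_bigr do rewrite dotC dot_centroidr; by rewrite -mulr_suml.
have F1P i j : \sum_(b | cl b == j) `|F1 i b| <= if j == i then S i / l i else O j i / l i.
  rewrite /F1; case: ifPn => [/eqP ->|ji].
    rewrite (eq_bigr (fun b => 1 - dot (u i) (x b))) => [|b /eqP ->]; last first.
      by rewrite eqxx distrC ger0_norm // subr_ge0.
    rewrite sumrB constE uxE overlap_diag le_eqVlt; apply/orP; left; apply/eqP.
    by field; rewrite gt_eqF.
  rewrite (eq_bigr (fun b => dot (u i) (x b))) => [|b /eqP ->]; first by rewrite uxE.
  by rewrite eq_sym (negPf ji) subr0 ger0_norm.
have F2P i j : \sum_(b | cl b == j) `|F2 i b| <= if j == i then S i / l i else O j i / l i.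
  rewrite /F2; case: ifPn => [/eqP ->|ji].
    rewrite (eq_bigr (fun=> S i / l i ^+ 2)) => [|b /eqP ->]; last first.
      rewrite eqxx dot_centroid_diag // distrC opprB addrC subrK ger0_norm //.
      by apply: divr_ge0; [exact: deficit_ge0|exact/exprn_ge0/ltW].
    rewrite constE le_eqVlt; apply/orP; left; apply/eqP.
    by field; rewrite gt_eqF.
  rewrite (eq_bigr (fun=> O j i / (l j * l i))) => [|b /eqP ->]; last first.
    rewrite eq_sym (negPf ji) subr0 dotC dot_centroid ger0_norm //.
    by apply: divr_ge0; [exact: overlap_ge0|exact/ltW/mulr_gt0].
  rewrite constE le_eqVlt; apply/orP; left; apply/eqP.
  by field; rewrite !gt_eqF.
have -> : \sum_a \sum_b N a b * (dot (x a) (x b) - (cl a == cl b)%:R) =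
    \sum_a \sum_b N a b * dot (dev a) (dev b) +
    2 * (\sum_a \sum_b N a b * F1 (cl a) b) - \sum_a \sum_b N a b * F2 (cl a) b.
  have -> : 2 * (\sum_a \sum_b N a b * F1 (cl a) b) =
     \sum_a \sum_b N a b * F1 (cl a) b + \sum_a \sum_b N a b * F1 (cl b) a.
    rewrite mulr_natl mulr2n; congr (_ + _); rewrite exchange_big.
    by apply: eq_bigr => a _; apply: eq_bigr => b _; rewrite N_sym.
  rewrite -!big_split /= -sumrB; apply: eq_bigr => a _ /=.
  rewrite -!big_split /= -sumrB; apply: eq_bigr => b _ /=.
  rewrite /F1 /F2 /deviation dotBl !dotBr (dotC (u (cl b)) (x a)) [cl b == cl a]eq_sym.
  ring.
have := noise_dev_le; have := noise_cluster_le F1P; have := noise_cluster_le F2P.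
rewrite !ler_norml => /andP[? ?] /andP[? ?]; lra.
Qed.

(** The cost splits into a diagonal, an expected and a noise part. The expected part gains
    [bS + delta / 4 * off]. Noise leaves 60/64 of [bS], hence 15 - 1 = 14 sixty-fourths of [delta]
    for the deficits, and 16 - 3 = 13 for the overlaps. *)
Lemma inlier_cost_ge (K : 'I_n -> 'I_n -> R) :
    (forall a, N a a = 0) -> (forall a, K a a = 0) ->
    (forall a b, a != b -> K a b = B (cl a) (cl b) + N a b) ->
  (14 / 64 * delta - (alpha + 1) / nmin) * (\sum_i S i) + 13 / 64 * delta * off <=
  \sum_a \sum_b ((a == b)%:R * (alpha - lambda) + lambda - K a b) *
    (dot (x a) (x b) - (cl a == cl b)%:R).
Proof.
move=> Nd Kd KE.
pose D a b := dot (x a) (x b) - (cl a == cl b)%:R.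
have Daa a : D a a = - (1 - dot (x a) (x a)) by rewrite /D eqxx opprB.
have split_cost : \sum_a \sum_b ((a == b)%:R * (alpha - lambda) + lambda - K a b) * D a b =
    \sum_a (alpha + beta (cl a)) * D a a + \sum_a \sum_b (lambda - B (cl a) (cl b)) * D a b
    - \sum_a \sum_b N a b * D a b.
  rewrite -big_split /= -sumrB; apply: eq_bigr => a _ /=.
  rewrite -addrA -sumrB [LHS](bigD1 a) //= [in RHS](bigD1 a) //= eqxx mulr1n Kd Nd [RHS]addrA.
  rewrite /beta; congr (_ + _); first by ring.
  apply: eq_bigr => b; rewrite eq_sym => ab; rewrite KE // (negPf ab) mulr0n; ring.
have noise := noise_total_le.
have S0 i : 0 <= S i by exact: deficit_ge0.
have diag : - ((alpha + 1) / nmin * \sum_i S i) <= \sum_a (alpha + beta (cl a)) * D a a.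
  rewrite lerNl -sumrN mulr_sumr (partition_big cl xpredT) //=.
  apply: ler_sum => i _; apply: (@le_trans _ _ ((alpha + 1) * (S i / l i))).
    apply: (@le_trans _ _ ((alpha + 1) * \sum_(a | cl a == i) (1 - dot (x a) (x a)))).
      rewrite mulr_sumr; apply: ler_sum => a /eqP ->; rewrite Daa mulrN opprK.
      rewrite ler_wpM2r ?subr_ge0 // lerD2l /beta; have := B_le1 i i.
      by have := lambda_ge0; lra.
    rewrite ler_wpM2l ?addr_ge0 // ler_pdivlMr //.
    pose s := \sum_(a | cl a == i) (1 - dot (x a) (x a)).
    (* Symmetrization: as [x a - x b] has nonnegative squared norm, the mean of the two diagonal
       defects is at most [1 - dot (x a) (x b)]. *)
    have -> : s * l i = \sum_(a | cl a == i) \sum_(b | cl b == i)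
       ((1 - dot (x a) (x a)) + (1 - dot (x b) (x b))) / 2.
      transitivity ((s * l i + l i * s) / 2); first by field.
      rewrite {1}/s {2}/clsize !mulr_suml -big_split mulr_suml; apply: eq_bigr => a _ /=.
      by rewrite /clsize !mulr_sumr -big_split mulr_suml; apply: eq_bigr => b _ /=; ring.
    apply: ler_sum => a _; apply: ler_sum => b _.
    have := dot_ge0 (x a - x b); rewrite dotBl !dotBr (dotC (x b) (x a)); lra.
  rewrite -mulrA ler_wpM2l ?addr_ge0 // mulrC ler_wpM2r //.
  by rewrite lef_pV2 ?posrE.
have signal : bS + delta / 4 * off <= \sum_a \sum_b (lambda - B (cl a) (cl b)) * D a b.
  rewrite sum_clusters /bS /off mulr_sumr -big_split; apply: ler_sum => i _ /=.
  rewrite [leRHS](bigD1 i) //=; apply: lerD.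
    rewrite /deficit mulr_sumr; apply: ler_sum => a /eqP ai.
    rewrite mulr_sumr; apply: ler_sum => b /eqP bi.
    by rewrite /D ai bi eqxx mulr1n /beta; lra.
  rewrite mulr_sumr; apply: ler_sum => j ji; rewrite /overlap mulr_sumr.
  apply: ler_sum => a /eqP ai; rewrite mulr_sumr; apply: ler_sum => b /eqP bj.
  rewrite /D ai bj eq_sym (negPf ji) subr0 ler_wpM2r //.
  by apply: off_ge; rewrite eq_sym.
have bS_ge : delta / 4 * \sum_i S i <= bS.
  by rewrite mulr_sumr; apply: ler_sum => i _; rewrite ler_wpM2r // beta_ge.
rewrite -[X in _ <= X]/(\sum_a \sum_b _ * D a b) split_cost.
move: noise; rewrite -[X in X <= _ -> _]/(\sum_a \sum_b N a b * D a b); lra.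
Qed.

End Inliers.

(** * Optima of the semidefinite program *)

Lemma sdp_costE (R : realType) N (alpha lambda : R) (A : 'M[R]_N) i j :
  sdp_cost alpha lambda A i j = (i == j)%:R * (alpha - lambda) + lambda - A i j.
Proof. rewrite !mxE; case: (i == j); rewrite /= ?mulr1n ?mulr0n; ring. Qed.

Lemma trace_innerE (R : realType) N (X Y : 'M[R]_N) :
  trace_inner X Y = \sum_i \sum_j Y i j * X i j.
Proof.
rewrite exchange_big; apply: eq_bigr => j _; rewrite mxE.
by apply: eq_bigr => i _; rewrite mxE mulrC.
Qed.

Lemma sdp_cost_blocks (R : realType) n m (alpha lambda : R) (K : 'M[R]_n)
    (Z : 'M[R]_(n, m)) (W : 'M[R]_m) (X : 'M[R]_(n + m)) : X^T = X ->
  trace_inner X (sdp_cost alpha lambda (block_mx K Z Z^T W)) =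
  \sum_a \sum_b ((a == b)%:R * (alpha - lambda) + lambda - K a b) *
     X (lshift m a) (lshift m b) +
  (2 * (\sum_a \sum_b (lambda - Z a b) * X (lshift m a) (rshift n b)) +
   \sum_b \sum_c ((b == c)%:R * (alpha - lambda) + lambda - W b c) *
     X (rshift n b) (rshift n c)).
Proof.
move=> X_sym; rewrite trace_innerE big_split_ord /=.
under eq_bigr do rewrite big_split_ord /=.
under [X in _ + X]eq_bigr do rewrite big_split_ord /=.
rewrite !big_split /= -addrA; congr (_ + _).
  apply: eq_bigr => a _; apply: eq_bigr => b _.
  by rewrite sdp_costE block_mxEul (inj_eq (@lshift_inj _ _)).
rewrite addrA mulr_natl mulr2n; congr (_ + _ + _).
- apply: eq_bigr => a _; apply: eq_bigr => b _.
  by rewrite sdp_costE block_mxEur eq_lrshift mul0r add0r.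
- rewrite exchange_big; apply: eq_bigr => a _; apply: eq_bigr => b _.
  by rewrite sdp_costE block_mxEdl eq_rlshift mul0r add0r mxE -[in LHS]X_sym mxE.
apply: eq_bigr => a _; apply: eq_bigr => b _.
by rewrite sdp_costE block_mxEdr (inj_eq (@rshift_inj _ _)).
Qed.

Section Optimum.
Context {R : realType} {n r m : nat}.
Variable cl : 'I_n -> 'I_r.
Variables (K : 'M[R]_n) (Z : 'M[R]_(n, m)) (W : 'M[R]_m) (B : 'I_r -> 'I_r -> R).
Variables (alpha lambda p delta nmin : R).
Local Notation l := (@clsize R n r cl).
Let A := block_mx K Z Z^T W.
Let N a b := if a == b then 0 else K a b - B (cl a) (cl b).

(** The Gram matrix of the basis vectors of the communities, one for each inlier, and of the columns
    of [z]. *)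
Lemma cluster_feasible (z : 'I_r -> 'I_m -> R) : quarter_ball z ->
  exists Y : 'M[R]_(n + m), [/\ sdp_feasible Y,
    forall a b, Y (lshift m a) (lshift m b) = (cl a == cl b)%:R,
    forall a b, Y (lshift m a) (rshift n b) = z (cl a) b &
    forall b c, Y (rshift n b) (rshift n c) = \sum_i z i b * z i c].
Proof.
move=> [z0 z1].
pose G : 'M[R]_(n + m, r) := col_mx (\matrix_(a, i) (cl a == i)%:R) (\matrix_(b, i) z i b).
pose Y := G *m G^T.
have Gl a i : G (lshift m a) i = (cl a == i)%:R by rewrite col_mxEu mxE.
have Gr b i : G (rshift n b) i = z i b by rewrite col_mxEd mxE.
have Ylx a j : Y (lshift m a) j = G j (cl a).
  rewrite mxE (bigD1 (cl a)) //= big1 => [|i ai].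
    by rewrite Gl eqxx mul1r addr0 mxE.
  by rewrite Gl eq_sym (negPf ai) mul0r.
have Yll a b : Y (lshift m a) (lshift m b) = (cl a == cl b)%:R.
  by rewrite Ylx Gl eq_sym.
have Ylr a b : Y (lshift m a) (rshift n b) = z (cl a) b by rewrite Ylx Gr.
have Yrr b c : Y (rshift n b) (rshift n c) = \sum_i z i b * z i c.
  by rewrite mxE; apply: eq_bigr => i _; rewrite [G^T _ _]mxE !Gr.
have Y_sym : Y^T = Y by rewrite trmx_mul trmxK.
exists Y; split=> //; split; first split=> //.
  move=> v; rewrite /Y mulmxA -mulmxA.
  have -> : v^T *m G = (G^T *m v)^T by rewrite trmx_mul trmxK.
  by rewrite mxE; apply: sumr_ge0 => i _; rewrite mxE -expr2 sqr_ge0.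
have z1' i b : z i b <= 1.
  rewrite -(@ler_pXn2r _ 2) ?nnegrE // expr1n; apply: le_trans (z1 b).
  by rewrite (bigD1 i) //= lerDl; apply: sumr_ge0 => j _; exact: sqr_ge0.
move=> i j; case: (split_ordP i) => a ->; case: (split_ordP j) => b ->.
- by rewrite Yll; case: eqP => _; rewrite ?lexx ?ler01.
- by rewrite Ylr z0 z1'.
- by rewrite -Y_sym mxE Ylr z0 z1'.
rewrite Yrr sumr_ge0 /= => [|k _]; last exact: mulr_ge0.
apply: (@le_trans _ _ ((\sum_i z i a ^+ 2 + \sum_i z i b ^+ 2) / 2)); last first.
  by have := z1 a; have := z1 b; lra.
rewrite -big_split mulr_suml; apply: ler_sum => k _ /=.
by have := sqr_ge0 (z k a - z k b); rewrite sqrrB; lra.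
Qed.

Lemma sdp_optimum_inliers (X : 'M[R]_(n + m)) :
    adjacency_mx K -> zero_one_mx Z -> adjacency_mx W ->
    (forall i j, B i j = B j i) -> (forall i j, B i j <= 1) ->
    (forall i, delta / 4 <= B i i - lambda) ->
    (forall i j, i != j -> delta / 4 <= lambda - B i j) ->
    0 < delta -> 0 <= lambda <= 1 -> lambda <= p -> 3 * m%:R <= alpha ->
    0 < nmin -> (forall i, nmin <= l i) -> m%:R <= nmin ->
    (alpha + 1) / nmin + 5 * m%:R / nmin + m%:R / nmin *
       (2 * (p * n%:R) / (alpha - 2 * m%:R) + 4 * Num.sqrt r%:R) <= 12 / 64 * delta ->
    (forall a j, `|\sum_(b | cl b == j) N a b| <=
      (if cl a == j then B j j - lambda else delta) * l j / 64) ->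
    (forall i (v : 'I_n -> R),
      \sum_a \sum_b ((cl a == i) && (cl b == i))%:R * N a b * v a * v b <=
      (B i i - lambda) * l i / 64 * \sum_a v a ^+ 2) ->
    (forall v : 'I_n -> R,
      \sum_a \sum_b (cl a != cl b)%:R * N a b * v a * v b <=
      delta * nmin / 64 * \sum_a v a ^+ 2) ->
    sdp_solution alpha lambda A X ->
  forall a b, X (lshift m a) (lshift m b) = (cl a == cl b)%:R.
Proof.
move=> [_ K_sym Kd] Z01 [W01 W_sym Wd] B_sym B1 betaP offP d0 l01 lp alphaP nm0 nmP m_nm
  budget rowP diagP offspP [[[X_sym X_psd] X01] X_opt].
have [l0 l1] := andP l01.
have alpha0 : 0 <= alpha by have := ler0n R m; lra.
have N_sym a b : N a b = N b a.
  by rewrite /N eq_sym B_sym -[in K a b]K_sym mxE.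
have [G XG] := psd_gram X_sym X_psd.
have dotG i j : dot (row i G) (row j G) = X i j.
  by rewrite XG mxE; apply: eq_bigr => k _; rewrite !mxE.
pose x a := row (lshift m a) G; pose w b := row (rshift n b) G.
pose Q b c := (b == c)%:R * (alpha - lambda) + lambda - W b c.
pose e i b := \sum_(a | cl a == i) (lambda - Z a b).
have Q_sym b c : Q b c = Q c b by rewrite /Q eq_sym -[in W b c]W_sym mxE.
have Q_diag b : Q b b = alpha by rewrite /Q eqxx mul1r Wd; lra.
have Q_off b c : b != c -> `|Q b c| <= 1.
  move=> /negPf bc; rewrite /Q bc mul0r add0r ler_norml.
  by case: (W01 b c) => ->; lra.
have [z [nu [z_ball nu0 phi0 phiz nuz]]] := qp_kkt e Q_sym.
have [Y [Yfeas Yll Ylr Yrr]] := cluster_feasible z_ball.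
have Y_sym : Y^T = Y by case: Yfeas => -[].
have costle := X_opt _ Yfeas.
have x01 a b : 0 <= dot (x a) (x b) <= 1 by rewrite dotG.
have xw0 a b : 0 <= dot (x a) (w b) by rewrite dotG; case/andP: (X01 (lshift m a) (rshift n b)).
have w1 b : dot (w b) (w b) <= 1 by rewrite dotG; case/andP: (X01 (rshift n b) (rshift n b)).
have rho0 : 0 <= Num.sqrt (r%:R : R) by exact: sqrtr_ge0.
have rho2 : Num.sqrt (r%:R : R) ^+ 2 = r%:R by rewrite sqr_sqrtr.
have outl := outlier_cost_ge x01 xw0 w1 Z01 Q_sym Q_diag Q_off l01 lp alphaP nm0 nmP m_nm
  rho0 rho2 z_ball nu0 phi0 phiz nuz.
have Nd a : N a a = 0 by rewrite /N eqxx.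
have KE a b : a != b -> K a b = B (cl a) (cl b) + N a b.
  by move=> /negPf ab; rewrite /N ab addrC subrK.
have inl := inlier_cost_ge x01 nm0 nmP d0 betaP offP l0 B1 alpha0 N_sym rowP diagP offspP
  Nd Kd KE.
pose E11 a b := (a == b)%:R * (alpha - lambda) + lambda - K a b.
have costX : trace_inner X (sdp_cost alpha lambda A) =
    \sum_a \sum_b E11 a b * dot (x a) (x b) +
    (2 * (\sum_a \sum_b (lambda - Z a b) * dot (x a) (w b)) +
     \sum_b \sum_c Q b c * dot (w b) (w c)).
  rewrite sdp_cost_blocks //; congr (_ + (2 * _ + _));
  by apply: eq_bigr => a _; apply: eq_bigr => b _; rewrite dotG.
have costY : trace_inner Y (sdp_cost alpha lambda A) =
    \sum_a \sum_b E11 a b * (cl a == cl b)%:R + qp_cost e Q z.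
  rewrite sdp_cost_blocks //; congr (_ + (2 * _ + _)).
  - by apply: eq_bigr => a _; apply: eq_bigr => b _; rewrite Yll.
  - rewrite exchange_big [RHS]exchange_big; apply: eq_bigr => b _ /=.
    rewrite (partition_big cl xpredT) //=; apply: eq_bigr => i _.
    by rewrite /e mulr_suml; apply: eq_bigr => a /eqP <-; rewrite Ylr.
  rewrite [RHS]exchange_big; apply: eq_bigr => b _ /=.
  rewrite [RHS]exchange_big; apply: eq_bigr => c _ /=.
  by rewrite Yrr mulr_sumr; apply: eq_bigr => i _; rewrite mulrA.
have cost11 : \sum_a \sum_b E11 a b * (dot (x a) (x b) - (cl a == cl b)%:R) =
    \sum_a \sum_b E11 a b * dot (x a) (x b) - \sum_a \sum_b E11 a b * (cl a == cl b)%:R.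
  rewrite -sumrB; apply: eq_bigr => a _; rewrite -sumrB; apply: eq_bigr => b _.
  by rewrite mulrBr.
have S0 i : 0 <= deficit cl x i by exact: deficit_ge0.
have O0 i j : 0 <= overlap cl x i j by exact: overlap_ge0.
pose SS := \sum_i deficit cl x i; pose OO := \sum_i \sum_(j | j != i) overlap cl x i j.
have SS0 : 0 <= SS by exact: sumr_ge0.
have OO0 : 0 <= OO by apply: sumr_ge0 => i _; exact: sumr_ge0.
have SO : SS + OO = 0.
  have : SS + OO <= 0; last by move=> ?; apply/le_anti; rewrite addr_ge0 // andbT.
  move: costle outl inl; rewrite costX costY.
  rewrite -[X in _ -> _ -> _ <= X -> _]/(\sum_a \sum_b E11 a b * (dot (x a) (x b) - (cl a == cl b)%:R)).
  rewrite cost11 -/SS -/OO.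
  move: (\sum_a \sum_b E11 a b * _) (\sum_a \sum_b E11 a b * _) (qp_cost e Q z).
  move: (2 * _ + _) => t1 t2 t3 t4 H1 H2 H3.
  pose k1 := (alpha + 1) / nmin; pose k2 := 5 * m%:R / nmin.
  pose k3 := m%:R / nmin * (2 * (p * n%:R) / (alpha - 2 * m%:R) + 4 * Num.sqrt r%:R).
  have k1_ge0 : 0 <= k1 by rewrite divr_ge0 ?addr_ge0 // ltW.
  have p0 : 0 <= p by exact: le_trans lp.
  have k3_ge0 : 0 <= k3.
    apply: mulr_ge0; first by rewrite divr_ge0 // ltW.
    apply: addr_ge0; last by rewrite mulr_ge0.
    by apply: divr_ge0; [rewrite !mulr_ge0|have := ler0n R m; lra].
  have k123 : k1 + k2 + k3 <= 12 / 64 * delta by exact: budget.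
  have k3E : m%:R * (SS / nmin * (2 * (p * n%:R) / (alpha - 2 * m%:R) + 4 * Num.sqrt r%:R))
    = k3 * SS by rewrite /k3; ring.
  move: H2 H3; rewrite k3E -/k1 -/k2 => H2 H3.
  (* The budget consumes 12/64 of [delta] out of the gains 14/64 and 13/64. *)
  have : (1 / 64 * delta) * (SS + OO) <= 0 by nra.
  by rewrite pmulr_rle0 // mulr_gt0.
have SSe : SS = 0 by apply/le_anti; rewrite SS0 andbT -SO lerDl.
have OOe : OO = 0 by apply/le_anti; rewrite OO0 andbT -SO lerDr.
move=> a b; rewrite -dotG -/(x a) -/(x b).
have [ab|ab] := eqVneq (cl a) (cl b).
  have /eqP := psumr_eq0P (fun i _ => S0 i) SSe (i := cl b) isT.
  rewrite psumr_eq0 => [/allP /(_ a)|i _]; last by apply: sumr_ge0 => j _;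
    rewrite subr_ge0; case/andP: (x01 i j).
  rewrite mem_index_enum ab eqxx /= => /(_ isT); rewrite psumr_eq0 => [/allP /(_ b)|i _];
    last first.
    by rewrite subr_ge0; case/andP: (x01 a i).
  by rewrite mem_index_enum eqxx /= subr_eq0 => /(_ isT) /eqP.
have /eqP := psumr_eq0P (fun i _ => sumr_ge0 _ (fun j _ => O0 i j)) OOe (i := cl a) isT.
rewrite psumr_eq0 // => /allP /(_ (cl b)); rewrite mem_index_enum eq_sym ab /= => /(_ isT).
rewrite /overlap psumr_eq0 => [/allP /(_ a)|i _]; last first.
  by apply: sumr_ge0 => j _; case/andP: (x01 i j).
rewrite mem_index_enum eqxx /= => /(_ isT); rewrite psumr_eq0 => [/allP /(_ b)|i _]; last first.
  by case/andP: (x01 a i).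
by rewrite mem_index_enum eqxx /= => /(_ isT) /eqP.
Qed.
End Optimum.

(** * From the random graph to the product space *)

(** [M] takes finitely many values, each on a measurable set, so even a [Phi] that quantifies over
    all solutions of the program defines an event. *)
Lemma measurable_zero_one_event (R : realType) d (T : measurableType d) a b
    (M : T -> 'M[R]_(a, b)) (Phi : 'M[R]_(a, b) -> Prop) :
  random_mx M -> (forall w, zero_one_mx (M w)) -> measurable [set w | Phi (M w)].
Proof.
move=> M_rand M01.
pose mat (k : {ffun 'I_a * 'I_b -> bool}) : 'M[R]_(a, b) := \matrix_(i, j) (k (i, j))%:R.
have -> : [set w | Phi (M w)] = \bigcup_(k in [set k | Phi (mat k)])
    \bigcap_(ij in [set: 'I_a * 'I_b])
      ([set: T] `&` (fun w => M w ij.1 ij.2) @^-1` [set mat k ij.1 ij.2]).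
  apply/seteqP; split => w /=.
    move=> PhiM; pose k := [ffun ij : 'I_a * 'I_b => M w ij.1 ij.2 == 1].
    have Mk : mat k = M w.
      by apply/matrixP => i j; rewrite !mxE ffunE /=; case: (M01 w i j) => ->;
        rewrite ?eqxx // eq_sym oner_eq0.
    by exists k; rewrite /= ?Mk // => ij _; split=> //=; rewrite Mk.
  move=> [k /= Phik kw]; suff -> : M w = mat k by [].
  by apply/matrixP => i j; have [_ /=] := kw (i, j) I.
apply: fin_bigcup_measurable => [|k _]; first exact: finite_finset.
apply: fin_bigcap_measurable => [|ij _]; first exact: finite_finset.
by apply: M_rand => //; exact: measurable_set1.
Qed.

Section Transfer.
Context {R : realType} {d : measure_display} {T : measurableType d}.
Variables (Pr : probability T R) (n : nat).
Variables (K : T -> 'M[R]_n) (pe : 'I_n -> 'I_n -> R).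
Hypothesis K_random : random_mx K.
Hypothesis K_adj : forall w, adjacency_mx (K w).
Hypothesis K_indep : mutually_independent Pr
    [set ab : 'I_n * 'I_n | (ab.1 < ab.2)%N]%SET (fun ab w => K w ab.1 ab.2).
Hypothesis K_bern : forall a b : 'I_n, (a < b)%N ->
    Pr [set w | K w a b = 1] = (pe a b)%:E.

(** Configurations live on all ordered pairs; outside the strict upper triangle the edge is almost
    surely absent. *)
Definition edge_prob (e : 'I_n * 'I_n) : R := if (e.1 < e.2)%N then pe e.1 e.2 else 0.

Definition edge_config (M : 'M[R]_n) : {ffun 'I_n * 'I_n -> bool} :=
  [ffun e : 'I_n * 'I_n => (e.1 < e.2)%N && (M e.1 e.2 == 1)].

Let K01 w : zero_one_mx (K w). Proof. by case: (K_adj w). Qed.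

(** A configuration with an edge outside the strict upper triangle is never attained and has weight
    0; for the others the event prescribes the independent entries above the diagonal. *)
Lemma edge_config_weight k :
  Pr [set w | edge_config (K w) = k] = (bern_weight edge_prob k)%:E.
Proof.
have [/existsP [e /andP[ek /negPf eD]]|/existsPn kD] :=
    boolP [exists e : 'I_n * 'I_n, k e && ~~ (e.1 < e.2)%N].
  rewrite (_ : [set w | _] = set0); last first.
    apply/seteqP; split => // w /= /(congr1 (fun f : {ffun _ -> bool} => f e)).
    by rewrite ffunE eD ek.
  rewrite measure0 /bern_weight (bigD1 e) //= ek /edge_prob eD mul0r //.
pose D : {set 'I_n * 'I_n} := [set ab : 'I_n * 'I_n | (ab.1 < ab.2)%N]%SET.
pose U (e : 'I_n * 'I_n) : set R := if k e then [set 1] else [set 0].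
have -> : [set w | edge_config (K w) = k] =
    \bigcap_(e in [set e | e \in D]) ((fun w => K w e.1 e.2) @^-1` U e).
  apply/seteqP; split => w /=.
    move=> kE e /=; rewrite inE => eD; rewrite /U -kE ffunE eD /=.
    by case: eqP => // K1; case: (K01 w e.1 e.2).
  move=> H; apply/ffunP => e; rewrite ffunE; have := kD e.
  case: ltnP => [eD _|_ /=]; last by rewrite andbT => /negPf ->.
  have /= := H e; rewrite inE => /(_ eD); rewrite /U /=.
  by case: (k e) => /= ->; rewrite ?eqxx // eq_sym oner_eq0.
rewrite K_indep //; last first.
  by move=> e; rewrite /U; case: ifP => _; exact: measurable_set1.
rewrite /bern_weight [X in _ = X%:E](bigID (fun e => e \in D)) /=.
rewrite [X in (_ * X)%:E]big1 ?mulr1 => [|e]; last first.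
  rewrite inE => /negPf eD; have := kD e; rewrite eD andbT => /negPf ->.
  by rewrite /edge_prob eD subr0.
rewrite -prodEFin.
apply: eq_bigr => e; rewrite inE => eD; rewrite /edge_prob eD /U.
have m1 : measurable [set w | K w e.1 e.2 = 1].
  have := K_random e.1 e.2 measurableT (measurable_set1 1).
  by rewrite setTI.
case: (k e); first by rewrite -K_bern.
have -> : (fun w => K w e.1 e.2) @^-1` [set 0] = ~` [set w | K w e.1 e.2 = 1].
  apply/seteqP; split => w /=; first by move=> -> /esym/eqP; rewrite oner_eq0.
  by case: (K01 w e.1 e.2).
by rewrite probability_setC // K_bern.
Qed.

Lemma edge_config_event (A : pred {ffun 'I_n * 'I_n -> bool}) :
  Pr [set w | A (edge_config (K w))] = (\sum_(k | A k) bern_weight edge_prob k)%:E.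
Proof.
have -> : [set w | A (edge_config (K w))] =
    \bigcup_(k in [set` A]) [set w | edge_config (K w) = k].
  apply/seteqP; split => w /=; first by move=> Aw; exists (edge_config (K w)).
  by move=> [k /= Ak ->].
rewrite measure_fin_bigcup //; last 2 first.
- by move=> k k' _ _ [w [/= <- <-]].
- move=> k _; exact: (measurable_zero_one_event (fun M => edge_config M = k) K_random K01).
rewrite -(@bigfs _ _ _ _ (index_enum _)) ?index_enum_uniq //; last first.
  by move=> i _; rewrite mem_index_enum.
rewrite -sumEFin; apply: eq_bigr => k _; exact: edge_config_weight.
Qed.

End Transfer.

Lemma sum_union_le (R : realDomainType) (I T : finType) (F : T -> R)
    (A : I -> pred T) : (forall t, 0 <= F t) ->
  \sum_(t | [exists i, A i t]) F t <= \sum_i \sum_(t | A i t) F t.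
Proof.
move=> F0; rewrite (exchange_big_dep xpredT) //= big_mkcond; apply: ler_sum => t _.
case: ifP => [/existsP [i Ai]|_]; last exact: sumr_ge0.
by rewrite (bigD1 i) //= lerDl; apply: sumr_ge0.
Qed.

(** * Configurations with small deviations *)

Section GoodEvent.
Context {R : realType} {n r : nat}.
Variables (cl : 'I_n -> 'I_r) (B : 'I_r -> 'I_r -> R) (J : nat).
Variables (l : 'I_r -> R) (q : R).
Variables (srow : 'I_r -> 'I_r -> R) (sdiag : 'I_r -> R) (soff : R).
(** A power of two, as required by the repeated squaring in [trace_power_quadratic]. *)
Let L := (2 ^ J.+1)%N.
Let pr : 'I_n * 'I_n -> R := edge_prob (fun a b => B (cl a) (cl b)).
Let big_enough (s V : R) : Prop := 128 * L%:R <= s /\ 128 ^+ 2 * V * L%:R <= s ^+ 2.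

Hypothesis B01 : forall i j, 0 <= B i j <= 1.
Hypothesis B_sym : forall i j, B i j = B j i.
Hypothesis lE : forall i, \sum_(a | cl a == i) 1 = l i.
Hypothesis q_ge0 : 0 <= q.
Hypothesis B_off : forall i j, i != j -> B i j <= q.
Hypothesis row_big : forall i j, big_enough (srow i j) (B i j * l j).
Hypothesis diag_big : forall i, big_enough (sdiag i) (B i i * l i).
Hypothesis off_big : big_enough soff (n%:R * q).

Definition edge (a b : 'I_n) : 'I_n * 'I_n := if (a < b)%N then (a, b) else (b, a).

Lemma edge_sym a b : edge a b = edge b a.
Proof. by rewrite /edge; case: ltngtP => // /val_inj ->. Qed.

Lemma edge_end u v a b : edge u v = edge a b -> u = a \/ u = b.
Proof. by rewrite /edge; case: ifP => _; case: ifP => _ -[? ?]; auto. Qed.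

Definition noise k a b : R := if a == b then 0 else bern_noise pr k (edge a b).

Lemma edge_prob01 e : 0 <= pr e <= 1.
Proof. by rewrite /pr /edge_prob; case: ifP => // _; rewrite lexx ler01. Qed.

Lemma pr_edge a b : a != b -> pr (edge a b) = B (cl a) (cl b).
Proof.
move=> ab; rewrite /pr /edge_prob /edge; case: (ltngtP a b) => /= h; rewrite ?h //.
by move: ab; rewrite (val_inj h) eqxx.
Qed.

Let row_bad (aj : 'I_n * 'I_r) (k : {ffun 'I_n * 'I_n -> bool}) :=
  srow (cl aj.1) aj.2 < `|\sum_b ((cl b == aj.2) && (b != aj.1))%:R * bern_noise pr k (edge aj.1 b)|.
Let mx_of (c : 'I_n -> 'I_n -> bool) k : 'M[R]_n :=
  \matrix_(a, b) ((c a b)%:R * bern_noise pr k (edge a b)).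
Let cdiag i a b := [&& cl a == i, cl b == i & a != b].
Let diag_bad i k := sdiag i ^+ L <= \tr (mx_of (cdiag i) k ^+ L).
Let coff a b := cl a != cl b.
Let off_bad k := soff ^+ L <= \tr (mx_of coff k ^+ L).

Definition good_config k :=
  ~~ [|| [exists aj, row_bad aj k], [exists i, diag_bad i k] | off_bad k].

Let L_even : ~~ odd L. Proof. by rewrite /L expnS mul2n odd_double. Qed.
Let L_gt0 : (0 < L)%N. Proof. by rewrite expn_gt0. Qed.

Let edge_injective a : injective (edge a).
Proof.
move=> b c bc; have /edge_end [] : edge b a = edge c a by rewrite -!(edge_sym a).
  by [].
move=> ba; move: bc; rewrite ba => /esym; rewrite edge_sym => /edge_end [] //.
Qed.

(** Union bound over [n * r] row sums, [r] diagonal blocks and the off-diagonal part; each trace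
    costs a factor [n]. *)
Lemma bad_config_weight : \sum_(k | ~~ good_config k) bern_weight pr k <=
  (n * r + r * n + n)%:R / 64 ^+ L.
Proof.
have w0 k : 0 <= bern_weight pr k by apply: bern_weight_ge0; exact: edge_prob01.
have l0 i : 0 <= l i by rewrite -lE sumr_ge0.
apply: (@le_trans _ _ (\sum_(k | [exists aj, row_bad aj k]) bern_weight pr k +
   \sum_(k | [exists i, diag_bad i k]) bern_weight pr k +
   \sum_(k | off_bad k) bern_weight pr k)).
  rewrite [leLHS]big_mkcond [X in _ <= X + _ + _]big_mkcond.
  rewrite [X in _ <= _ + X + _]big_mkcond [X in _ <= _ + X]big_mkcond.
  rewrite -!big_split; apply: ler_sum => k _ /=.
  rewrite /good_config negbK; have := w0 k.
  by case: [exists aj, _]; case: [exists i, _]; case: (off_bad k) => /=; lra.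
rewrite natrD natrD !mulrDl; apply: lerD; first apply: lerD.
- apply: le_trans (sum_union_le _ w0) _.
  apply: (@le_trans _ _ (\sum_(aj : 'I_n * 'I_r) (64 ^+ L)^-1)); last first.
    by rewrite sumr_const card_prod !card_ord mulr_natl.
  apply: ler_sum => -[a j] _; have [s1 s2] := row_big (cl a) j.
  apply: (row_sum_tail edge_prob01 (@edge_injective a) _ _ L_gt0 L_even s1 s2).
    by move=> b; rewrite ler0n lern1 leq_b1.
  rewrite -lE mulr_sumr [leRHS]big_mkcond; apply: ler_sum => b _ /=.
  case: eqP => [<-|] /=; last by rewrite mul0r.
  case: eqVneq => [_|ba]; rewrite ?mul0r ?mulr1.
    by case/andP: (B01 (cl a) (cl b)).
  by rewrite mul1r pr_edge // eq_sym.
- apply: le_trans (sum_union_le _ w0) _.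
  apply: (@le_trans _ _ (\sum_(i < r) n%:R * (64 ^+ L)^-1)); last first.
    by rewrite sumr_const card_ord -[leLHS]mulr_natl mulrA natrM.
  apply: ler_sum => i _; have [s1 s2] := diag_big i.
  apply: (trace_power_tail edge_prob01 edge_sym edge_end _ _ _ _ L_gt0 L_even s1 s2).
  + by move=> a b; rewrite ler0n lern1 leq_b1.
  + by move=> a b; rewrite /cdiag [b == a]eq_sym andbCA.
  + move=> a; rewrite -lE mulr_sumr [leRHS]big_mkcond; apply: ler_sum => b _ /=.
    rewrite /cdiag; case: eqP => [bi|] /=; last by rewrite mul0r.
    case: eqP => [ai|_] /=; last by rewrite mul0r mulr1; case/andP: (B01 i i).
    case: eqVneq => [_|ba]; rewrite ?mul0r ?mulr1; first by case/andP: (B01 i i).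
    by rewrite mul1r pr_edge // bi ai.
  + by apply: mulr_ge0 => //; case/andP: (B01 i i).
- have [s1 s2] := off_big.
  apply: (trace_power_tail edge_prob01 edge_sym edge_end _ _ _ _ L_gt0 L_even s1 s2).
  + by move=> a b; rewrite ler0n lern1 leq_b1.
  + by move=> a b; rewrite /coff eq_sym.
  + move=> a; apply: (@le_trans _ _ (\sum_(b < n) q)); last first.
      by rewrite sumr_const card_ord mulr_natl.
    apply: ler_sum => b _; rewrite /coff; case: eqVneq => [|ba]; rewrite ?mul0r //.
    by rewrite mul1r pr_edge ?B_off //; apply: contraNneq ba => ->.
  + by rewrite mulr_ge0.
Qed.

Lemma good_config_row k a j : good_config k ->
  `|\sum_(b | cl b == j) noise k a b| <= srow (cl a) j.
Proof.
rewrite /good_config !negb_or => /andP[/existsPn /(_ (a, j)) H _]; move: H.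
rewrite /row_bad -leNgt /=; congr (`|_| <= _).
rewrite [RHS]big_mkcond; apply: eq_bigr => b _ /=; rewrite /noise [b == a]eq_sym.
by case: (cl b == j); case: (a == b); rewrite /= ?mul0r ?mul1r.
Qed.

Lemma good_config_quadratic (c : 'I_n -> 'I_n -> bool) k s (v : 'I_n -> R) :
    (forall a b, c a b = c b a) -> 0 <= s -> ~~ (s ^+ L <= \tr (mx_of c k ^+ L)) ->
  \sum_a \sum_b (c a b)%:R * bern_noise pr k (edge a b) * v a * v b <=
  s * \sum_a v a ^+ 2.
Proof.
move=> c_sym s0; rewrite -ltNge => /ltW trle.
have mx_sym : (mx_of c k)^T = mx_of c k.
  by apply/matrixP => a b; rewrite !mxE c_sym edge_sym.
have := trace_power_quadratic (\row_a v a) mx_sym s0 trle.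
rewrite !mxE; congr (_ <= _ * _).
  rewrite exchange_big; apply: eq_bigr => b _ /=; rewrite !mxE mulr_suml.
  by apply: eq_bigr => a _; rewrite !mxE; ring.
by apply: eq_bigr => b _; rewrite !mxE expr2.
Qed.

Lemma big_enough_ge0 s V : big_enough s V -> 0 <= s.
Proof. by case=> + _; apply: le_trans; rewrite mulr_ge0. Qed.

Lemma good_config_diag k i (v : 'I_n -> R) : good_config k ->
  \sum_a \sum_b ((cl a == i) && (cl b == i))%:R * noise k a b * v a * v b <=
  sdiag i * \sum_a v a ^+ 2.
Proof.
rewrite /good_config !negb_or => /and3P[_ /existsPn /(_ i) H _].
have := good_config_quadratic v _ (big_enough_ge0 (diag_big i)) H.
have c_sym a b : cdiag i a b = cdiag i b a by rewrite /cdiag [b == a]eq_sym andbCA.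
move=> /(_ c_sym); congr (_ <= _).
apply: eq_bigr => a _; apply: eq_bigr => b _; rewrite /noise /cdiag.
by case: (cl a == i); case: (cl b == i); case: (a == b); rewrite /= ?mulr0 ?mul0r.
Qed.

Lemma good_config_off k (v : 'I_n -> R) : good_config k ->
  \sum_a \sum_b (cl a != cl b)%:R * noise k a b * v a * v b <=
  soff * \sum_a v a ^+ 2.
Proof.
rewrite /good_config !negb_or => /and3P[_ _ H].
have := good_config_quadratic v _ (big_enough_ge0 off_big) H.
have c_sym a b : coff a b = coff b a by rewrite /coff eq_sym.
move=> /(_ c_sym); congr (_ <= _).
apply: eq_bigr => a _; apply: eq_bigr => b _; rewrite /noise /coff.
by have [->|_] := eqVneq a b; rewrite ?eqxx /= ?mulr0 ?mul0r.
Qed.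

End GoodEvent.

(** * Relabelling and numerical estimates *)

Lemma card_cluster r (l : 'I_r -> nat) (i : 'I_r) :
  #|[pred a : 'I_(\sum_i l i) | tagnat.sig1 a == i]| = l i.
Proof.
rewrite -[RHS]card_ord -(card_imset predT (f := @tagnat.Rank r l i)); last first.
  by move=> j k /(congr1 val)/eqP; rewrite tagnat.eq_Rank => /andP[_ /eqP/val_inj].
apply: eq_card => a; rewrite inE; apply/eqP/imsetP => [<-|[j _ ->]].
  by exists (tagnat.sig2 a); rewrite ?tagnat.sig2K.
exact: tagnat.Rank1K.
Qed.

Section Relabelling.
Context {R : realType} {N : nat}.
Implicit Types (s : 'S_N) (X M : 'M[R]_N).

Definition relabel s M : 'M[R]_N := perm_mx s *m M *m (perm_mx s)^T.

Lemma relabelE s M i j : relabel s M i j = M (s i) (s j).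
Proof. by rewrite /relabel tr_perm_mx -row_permE -col_permE !mxE. Qed.

Lemma relabelKV s : cancel (relabel s^-1) (relabel s).
Proof. by move=> M; apply/matrixP => i j; rewrite !relabelE !permK. Qed.

Lemma relabel_feasible s X : sdp_feasible X -> sdp_feasible (relabel s X).
Proof.
move=> [[X_sym X_psd] X01]; split; last by move=> i j; rewrite relabelE.
split; first by rewrite /relabel !trmx_mul trmxK X_sym mulmxA.
move=> v; have := X_psd ((perm_mx s)^T *m v).
by rewrite trmx_mul trmxK /relabel !mulmxA.
Qed.

Lemma relabel_cost s alpha lambda M X :
  trace_inner (relabel s X) (sdp_cost alpha lambda (relabel s M)) =
  trace_inner X (sdp_cost alpha lambda M).
Proof.
rewrite !trace_innerE [RHS](reindex_inj (@perm_inj _ s)); apply: eq_bigr => i _ /=.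
rewrite [RHS](reindex_inj (@perm_inj _ s)); apply: eq_bigr => j _ /=.
by rewrite !sdp_costE !relabelE (inj_eq (@perm_inj _ s)).
Qed.

(** The program is invariant under simultaneous permutations of rows and columns, which removes
    [P]. *)
Lemma relabel_solution s alpha lambda M X :
  sdp_solution alpha lambda (relabel s M) X ->
  sdp_solution alpha lambda M (relabel s^-1 X).
Proof.
move=> [Xf Xopt]; split; first exact: relabel_feasible.
move=> Y Yf; have := Xopt _ (relabel_feasible s Yf).
by rewrite relabel_cost -{1}[X](relabelKV s) relabel_cost.
Qed.

End Relabelling.

Lemma recovery_form_of_inliers (R : realType) r m (l : 'I_r -> nat)
    (P X : 'M[R]_(\sum_i l i + m)) : X^T = X ->
    (forall a b, X (lshift m a) (lshift m b) =
       (tagnat.sig1 a == tagnat.sig1 b)%:R) ->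
  recovery_form P (P *m X *m P^T).
Proof.
move=> X_sym XE; exists (submxcol (ursubmx X)), (drsubmx X).
congr (_ *m _ *m _); rewrite -[LHS]submxK; congr block_mx.
- apply/matrixP => a b; rewrite !mxE XE.
  case: (tagnat.sig1 a =P tagnat.sig1 b) => [ab|] /=; last by rewrite mxE.
  (* Once the two block indices are the same term, the conformity cast inside [\mxdiag] is the
     identity. *)
  move: (tagnat.sig2 a) (tagnat.sig2 b); rewrite -ab => a' b'.
  by rewrite conform_mx_id mxE.
- by rewrite submxcolK.
- by rewrite -tr_mxcol submxcolK trmx_ursub X_sym.
Qed.

(** From [ln (1 + x) <= x] at [x = - 1 / 2]. *)
Lemma ln2_ge_half (R : realType) : (1 / 2 : R) <= ln 2.
Proof.
have := @le_ln1Dx R (- (1 / 2)); rewrite (_ : 1 + - (1 / 2) = 2^-1); last by field.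
by rewrite lnV ?posrE // => /(_ _); lra.
Qed.

(** The binary logarithm of [n], rounded up to [u <= 4 * ln n], is rounded up again to a power of
    two; doubling the latter gives [2 ^ J.+1 <= 4 * u]. *)
Lemma log_scale (R : realType) (n : nat) : (2 <= n)%N ->
  exists J : nat, (n <= 2 ^ (2 ^ J.+1))%N /\ (2 ^ J.+1)%:R <= 16 * ln (n%:R : R).
Proof.
move=> n2; pose u := up_log 2 n; pose J := up_log 2 u; exists J.
have n_le : (n <= 2 ^ u)%N by exact: up_logP.
have u0 : (0 < u)%N by rewrite up_log_gt0.
have u_gt : (2 ^ u.-1 < n)%N by exact: up_log_gtn.
have uJ : (u <= 2 ^ J)%N by exact: up_logP.
have Ju : (2 ^ J <= 2 * u)%N.
  have [u1|u1] := leqP u 1.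
    by rewrite /J (_ : u = 1%N) ?up_log1 //; apply/eqP; rewrite eqn_leq u1.
  have := up_log_gtn (isT : (1 < 2)%N) u1; rewrite -/J.
  have : (0 < J)%N by rewrite up_log_gt0.
  by case: J {uJ} => // j _; rewrite /= expnS; lia.
split; first by apply: leq_trans n_le _; rewrite leq_exp2l // expnS; lia.
have ln2 := ln2_ge_half R.
have lnn : (u.-1)%:R * ln (2 : R) <= ln n%:R.
  rewrite mulr_natl -lnXn // -natrX ler_ln ?posrE ?ltr0n ?expn_gt0 //; last exact: leq_trans n2.
  by rewrite ler_nat ltnW.
have ln2n : ln (2 : R) <= ln n%:R by rewrite ler_ln ?posrE ?ltr0n ?ler_nat //;
  exact: leq_trans n2.
have uE : (u%:R : R) = (u.-1)%:R + 1 by rewrite -{1}(prednK u0) natr1.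
have u1_ge0 : (0 : R) <= (u.-1)%:R by rewrite ler0n.
have : ((2 ^ J.+1)%:R : R) <= 4 * u%:R by rewrite -natrM ler_nat expnS; lia.
rewrite uE; nra.
Qed.

(** The requirements of the tail bounds for deviation [s * l / 64] and variance [b * l], reduced to
    the smallest community. The constants are [128 * 16 * 64 = 2 ^ 17] and
    [128 ^ 2 * 16 * 64 ^ 2 = 2 ^ 30]. *)
Lemma threshold_large (R : realFieldType) (s b l nm X L : R) :
    0 <= b -> 0 < nm -> nm <= l -> 0 <= L -> L <= 16 * X ->
    2 ^+ 17 * X <= s * nm -> 2 ^+ 30 * (b * X) <= s ^+ 2 * nm ->
  128 * L <= s * l / 64 /\ 128 ^+ 2 * (b * l) * L <= (s * l / 64) ^+ 2.
Proof.
move=> b0 nm0 nml L0 LX sX sbX.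
have X0 : 0 <= X by lra.
have s0 : 0 <= s.
  rewrite -(pmulr_lge0 _ nm0); apply: le_trans sX; lra.
have sl : s * nm <= s * l by rewrite ler_wpM2l.
split; first lra.
have l0 : 0 < l by exact: lt_le_trans nml.
have sl2 : s ^+ 2 * nm <= s ^+ 2 * l by rewrite ler_wpM2l // sqr_ge0.
have -> : (s * l / 64) ^+ 2 = l * (s ^+ 2 * l / 64 ^+ 2) by field.
have -> : 128 ^+ 2 * (b * l) * L = l * (128 ^+ 2 * (b * L)) by ring.
rewrite ler_pM2l //.
have : b * L <= b * (16 * X) by rewrite ler_wpM2l.
lra.
Qed.

(** * Consequences of the lower bound on [delta], where [X] stands for the logarithm of [n] and
    [rho] for the square root of [r] *)

Section Signal.
Context {R : realType}.
Variables (X nm p q n alpha m rho delta : R).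
Hypothesis nm0 : 0 < nm.
Hypothesis X_ge : 1 / 2 <= X.
Hypothesis q0 : 0 <= q.
Hypothesis n0 : 0 <= n.
Hypothesis m0 : 0 <= m.
Hypothesis rho1 : 1 <= rho.
Hypothesis alpha_ge : 3 * m <= alpha.
Hypothesis p_ge : 2 ^+ 31 * (X / nm) <= p.
Hypothesis delta_gt : 2 ^+ 31 * (Num.sqrt (p * X / nm) + alpha / nm
   + Num.sqrt (n * q * X) / nm + m * rho / nm
   + n * m * p / ((alpha - 2 * m) * nm)) < delta.

Let X0 : 0 <= X. Proof. by move: X_ge; lra. Qed.
Let C0 : (0 : R) < 2 ^+ 31. Proof. exact: exprn_gt0. Qed.
Let p0 : 0 <= p.
Proof. by apply: le_trans p_ge; rewrite mulr_ge0 ?divr_ge0 // ltW. Qed.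
Let a2m0 : 0 <= alpha - 2 * m. Proof. by move: alpha_ge m0; lra. Qed.

Let t1 : 0 <= Num.sqrt (p * X / nm). Proof. exact: sqrtr_ge0. Qed.
Let t2 : 0 <= alpha / nm.
Proof. by apply: divr_ge0; [move: alpha_ge m0; lra | exact: ltW]. Qed.
Let t3 : 0 <= Num.sqrt (n * q * X) / nm.
Proof. by apply: divr_ge0; [exact: sqrtr_ge0 | exact: ltW]. Qed.
Let t4 : 0 <= m * rho / nm.
Proof.
apply: divr_ge0; last exact: ltW.
by apply: mulr_ge0 => //; exact: le_trans rho1.
Qed.
Let t5 : 0 <= n * m * p / ((alpha - 2 * m) * nm).
Proof. by apply: divr_ge0; apply: mulr_ge0 => //; [exact: mulr_ge0|exact: ltW]. Qed.

(** The lower bound on [p] gives [p * X / nm >= (X / nm) ^+ 2], so the square root in the bound on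
    [delta] is at least [X / nm]. *)
Lemma signal_ge_log : 2 ^+ 31 * X <= delta * nm.
Proof.
have C1 : (1 : R) <= 2 ^+ 31 by rewrite exprn_ege1 // ler1n.
have Xnm0 : 0 <= X / nm by rewrite divr_ge0 // ltW.
have : X / nm <= Num.sqrt (p * X / nm).
  rewrite -[leLHS](ger0_norm Xnm0) -sqrtr_sqr; apply: ler_wsqrtr.
  rewrite -mulrA expr2; apply: ler_wpM2r => //; apply: le_trans p_ge.
  by rewrite ler_peMl.
rewrite -(ler_pM2l C0) => h; rewrite -ler_pdivrMr // -mulrA; apply: (le_trans h).
apply: le_trans (ltW delta_gt); rewrite ler_pM2l //.
by move: t2 t3 t4 t5; lra.
Qed.

Lemma signal_ge_sqr : (2 ^+ 31) ^+ 2 * (p * X) <= delta ^+ 2 * nm.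
Proof.
have pX0 : 0 <= p * X / nm by apply: divr_ge0; [exact: mulr_ge0 | exact: ltW].
have h : 2 ^+ 31 * Num.sqrt (p * X / nm) <= delta.
  by apply: le_trans (ltW delta_gt); rewrite ler_pM2l //; move: t2 t3 t4 t5; lra.
have h0 : 0 <= 2 ^+ 31 * Num.sqrt (p * X / nm) by apply: mulr_ge0 => //; exact: ltW.
have : (2 ^+ 31 * Num.sqrt (p * X / nm)) ^+ 2 <= delta ^+ 2.
  by apply: lerXn2r; rewrite ?nnegrE // (le_trans h0).
by rewrite exprMn sqr_sqrtr // => h2; rewrite -ler_pdivrMr // -mulrA.
Qed.

Lemma signal_ge_off : (2 ^+ 31) ^+ 2 * (n * q * X) <= delta ^+ 2 * nm ^+ 2.
Proof.
have nq0 : 0 <= n * q * X by apply: mulr_ge0 => //; exact: mulr_ge0.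
have h : 2 ^+ 31 * (Num.sqrt (n * q * X) / nm) <= delta.
  by apply: le_trans (ltW delta_gt); rewrite ler_pM2l //; move: t1 t2 t4 t5; lra.
have h0 : 0 <= 2 ^+ 31 * (Num.sqrt (n * q * X) / nm) by apply: mulr_ge0 => //; exact: ltW.
have : (2 ^+ 31 * (Num.sqrt (n * q * X) / nm)) ^+ 2 <= delta ^+ 2.
  by apply: lerXn2r; rewrite ?nnegrE // (le_trans h0).
rewrite exprMn expr_div_n sqr_sqrtr // => h2.
have nm2 : 0 < nm ^+ 2 by exact: exprn_gt0.
by rewrite -(ler_pdivrMr _ _ nm2) -(mulrA (_ ^+ 2)) h2.
Qed.

(** The terms with [alpha], [m * rho] and [n * m * p] are together at most [delta / 2 ^+ 31];
    [1 / nm <= 2 * X / nm] is absorbed by [signal_ge_log]. *)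
Lemma signal_budget : (alpha + 1) / nm + 5 * m / nm +
  m / nm * (2 * (p * n) / (alpha - 2 * m) + 4 * rho) <= 12 / 64 * delta.
Proof.
have inv0 : 0 <= nm^-1 by rewrite invr_ge0 ltW.
have -> : m / nm * (2 * (p * n) / (alpha - 2 * m) + 4 * rho) =
    2 * (n * m * p / ((alpha - 2 * m) * nm)) + 4 * (m * rho / nm).
  by rewrite invfM; ring.
have h1 : nm^-1 <= 2 * (X / nm).
  by rewrite mulrA ler_peMl //; move: X_ge; lra.
have h2 : X / nm <= delta / 2 ^+ 31.
  by rewrite ler_pdivrMr // mulrAC ler_pdivlMr // mulrC; exact: signal_ge_log.
have h3 : m / nm <= m * rho / nm by rewrite ler_wpM2r // ler_peMr.
have h4 : alpha / nm + m * rho / nm + n * m * p / ((alpha - 2 * m) * nm) <= delta / 2 ^+ 31.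
  rewrite ler_pdivlMr // mulrC; apply: le_trans (ltW delta_gt).
  by rewrite ler_pM2l //; move: t1 t3; lra.
have d0 : 0 <= delta.
  rewrite -(pmulr_lge0 _ nm0); apply: le_trans signal_ge_log.
  by apply: mulr_ge0 => //; exact: ltW.
have h5 : delta / 2 ^+ 31 <= delta / 2 ^+ 10.
  by rewrite ler_wpM2l // lef_pV2 ?posrE ?exprn_gt0 // ler_weXn2l // ler1n.
rewrite mulrDl mul1r -mulrA; move: t2 t4 t5; lra.
Qed.

Lemma signal_outliers : delta <= 1 -> m <= nm.
Proof.
move=> d1.
have C1 : (1 : R) <= 2 ^+ 31 by rewrite exprn_ege1 // ler1n.
have h : m * rho / nm <= delta.
  apply: le_trans (ltW delta_gt).
  apply: (@le_trans _ _ (2 ^+ 31 * (m * rho / nm))); first by rewrite ler_peMl.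
  by rewrite ler_pM2l //; move: t1 t2 t3 t5; lra.
have : m * rho <= nm by rewrite -[leRHS]mul1r -ler_pdivrMr // (le_trans h).
by apply: le_trans; rewrite ler_peMr.
Qed.

(** A density [b] above [p] has more variance but also more margin: [(b - lambda)^2] is at least
    [(delta / 4)^2 + delta / 2 * (b - p)]. The first summand controls [p * X] by [signal_ge_sqr],
    the second [(b - p) * X] by [signal_ge_log]. *)
Lemma diag_threshold (b lambda l L : R) : p <= b -> lambda < p - delta / 4 ->
    nm <= l -> 0 <= L -> L <= 16 * X ->
  128 * L <= (b - lambda) * l / 64 /\
  128 ^+ 2 * (b * l) * L <= ((b - lambda) * l / 64) ^+ 2.
Proof.
move=> pb lam nml L0 LX.
have c1 := signal_ge_log; have c2 := signal_ge_sqr.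
have b0 : 0 <= b by exact: le_trans pb.
have d0 : 0 <= delta * nm by apply: le_trans c1; apply: mulr_ge0 => //; exact: ltW.
have be : delta / 4 + (b - p) <= b - lambda by lra.
apply: (@threshold_large _ _ _ _ nm X) => //.
  have : (delta / 4) * nm <= (b - lambda) * nm by rewrite ler_wpM2r ?(ltW nm0) //; lra.
  have := X0; lra.
have dl0 : 0 <= delta by rewrite -(pmulr_lge0 _ nm0).
have sq : (delta / 4) ^+ 2 + delta / 2 * (b - p) <= (b - lambda) ^+ 2.
  apply: (@le_trans _ _ ((delta / 4 + (b - p)) ^+ 2)).
    by have := sqr_ge0 (b - p); lra.
  by apply: lerXn2r; rewrite ?nnegrE; lra.
have : ((delta / 4) ^+ 2 + delta / 2 * (b - p)) * nm <= (b - lambda) ^+ 2 * nm.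
  by rewrite ler_wpM2r // ltW.
have : (2 ^+ 31 * X) * (b - p) <= (delta * nm) * (b - p).
  by rewrite ler_wpM2r // subr_ge0.
have pX : 0 <= p * X by exact: mulr_ge0.
have bpX : 0 <= (b - p) * X by apply: mulr_ge0 => //; rewrite subr_ge0.
lra.
Qed.

Lemma off_threshold (b l L : R) : 0 <= b -> b <= p -> 0 <= delta ->
    nm <= l -> 0 <= L -> L <= 16 * X ->
  128 * L <= delta * l / 64 /\ 128 ^+ 2 * (b * l) * L <= (delta * l / 64) ^+ 2.
Proof.
move=> b0 bp d0 nml L0 LX.
have c1 := signal_ge_log; have c2 := signal_ge_sqr.
apply: (@threshold_large _ _ _ _ nm X) => //; first by have := X0; lra.
apply: le_trans c2; have : b * X <= p * X by rewrite ler_wpM2r.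
by have : 0 <= b * X by [exact: mulr_ge0]; lra.
Qed.

Lemma total_threshold (L : R) : 0 <= delta -> 0 <= L -> L <= 16 * X ->
  128 * L <= delta * nm / 64 /\ 128 ^+ 2 * (n * q) * L <= (delta * nm / 64) ^+ 2.
Proof.
move=> d0 L0 LX.
have c1 := signal_ge_log; have c2 := signal_ge_off.
(* A fictitious community of size [nm] and density [n * q / nm] fits the form of
   [threshold_large]. *)
have -> : n * q = (n * q / nm) * nm by rewrite divfK ?gt_eqF.
apply: (@threshold_large _ _ _ _ nm X) => //.
- by apply: divr_ge0; [exact: mulr_ge0 | exact: ltW].
- by have := X0; lra.
rewrite -(ler_pM2r nm0).
have -> : 2 ^+ 30 * (n * q / nm * X) * nm = 2 ^+ 30 * (n * q * X) by field; rewrite gt_eqF.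
have : 0 <= n * q * X by apply: mulr_ge0 => //; exact: mulr_ge0.
lra.
Qed.

End Signal.

Lemma edge_config_noise (R : realType) n r (cl : 'I_n -> 'I_r) (B : 'I_r -> 'I_r -> R)
    (K : 'M[R]_n) : adjacency_mx K -> (forall i j, B i j = B j i) -> forall a b,
  noise cl B (edge_config K) a b = if a == b then 0 else K a b - B (cl a) (cl b).
Proof.
move=> [K01 K_sym _] B_sym a b; rewrite /noise; case: eqVneq => // ab.
rewrite /bern_noise pr_edge //; congr (_ - _).
have K_bool c d : (K c d == 1)%:R = K c d.
  by case: (K01 c d) => ->; rewrite ?eqxx // eq_sym oner_eq0.
have KC : K b a = K a b by rewrite -{1}K_sym mxE.
rewrite /edge; case: (ltngtP a b) => h; rewrite ffunE /= ?h ?K_bool //.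
by move: ab; rewrite (val_inj h) eqxx.
Qed.

(** [64 ^ L = (2 ^ L) ^ 6] is at least [n ^ 6], while the numerator times [n] is at most
    [4 * n ^ 3]. *)
Lemma bad_weight_le (R : realFieldType) (n r L : nat) :
  (2 <= n)%N -> (r <= n)%N -> (n <= 2 ^ L)%N ->
  (n * r + r * n + n)%:R / 64 ^+ L <= 1 / n%:R :> R.
Proof.
move=> n2 rn nL; have n0 : (0 < n)%N by exact: leq_trans n2.
rewrite ler_pdivrMr ?exprn_gt0 // mulrAC ler_pdivlMr ?ltr0n // mul1r.
rewrite -natrM -natrX ler_nat.
have -> : (64 ^ L = (2 ^ L) ^ 6)%N by rewrite -expnM mulnC expnM.
apply: (@leq_trans (n ^ 6)); last by rewrite leq_exp2r.
apply: (@leq_trans (n ^ 2 * 4 * n)).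
  rewrite leq_mul2r; apply/orP; right.
  have : (n * r <= n * n)%N by rewrite leq_mul2l rn orbT.
  rewrite mulnC; nia.
have -> : (n ^ 6 = n ^ 2 * n ^ 3 * n)%N by rewrite -expnD -expnSr.
rewrite leq_mul2r leq_mul2l; apply/orP; right; apply/orP; right.
by apply: (@leq_trans (2 ^ 3)) => //; rewrite leq_exp2r.
Qed.

(* For m = 0 the last summand of the lower bound on gap B has numerator 0, so it
   is 0 even when alpha = 0. *)
Theorem theorem3p1 (R : realType) :
  exists C c : R, 0 < C /\ 0 < c /\
  forall (d : measure_display) (T : measurableType d) (Pr : probability T R)
    (r m : nat) (l : 'I_r -> nat) (B : 'M[R]_r)
    (P : 'M[R]_(\sum_i l i + m)) (K : T -> 'M[R]_(\sum_i l i))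
    (Z : T -> 'M[R]_(\sum_i l i, m)) (W : T -> 'M[R]_m)
    (A : T -> 'M[R]_(\sum_i l i + m)) (alpha lambda : R),
  let n : R := (\sum_i l i)%N%:R in
  let nmin : R := (n_min l)%:R in
  let p := p_minus B in
  let q := q_plus B in
  let delta := gap B in
  (2 <= r)%N ->
  GSBM Pr B P K Z W A ->
  0 < delta ->
  p >= C * (ln n / nmin) ->
  alpha >= 3 * m%:R ->
  delta > C * (Num.sqrt (p * ln n / nmin) + alpha / nmin
               + Num.sqrt (n * q * ln n) / nmin
               + m%:R * Num.sqrt r%:R / nmin
               + n * m%:R * p / ((alpha - 2 * m%:R) * nmin)) ->
  q + delta / 4 < lambda < p - delta / 4 ->
  ((1 - 1 / n - 2 * r%:R / n ^+ 2 - c * r%:R / nmin ^+ 4)%:E <=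
   Pr [set w | forall X : 'M[R]_(\sum_i l i + m),
                 sdp_solution alpha lambda (A w) X -> recovery_form P X])%E.
Proof.
(* [2 ^+ 31] is the constant of the [Signal] estimates; as the bad configurations weigh at most
   [1 / n], any positive [c] will do. *)
exists (2 ^+ 31), 1; split; first exact: exprn_gt0.
split=> // d T Pr r m l B P K Z W A alpha lambda n nmin p q delta r2.
move=> [l_pos B_sym B01 P_perm K_rand K_adj K_ind K_ber Z_rand Z01 W_rand W_adj AE].
move=> d0 p_ge al_ge d_gt /andP[lam_lo lam_hi].
pose nn := (\sum_i l i)%N.
pose cl : 'I_nn -> 'I_r := @tagnat.sig1 r l.
have r_nn : (r <= nn)%N.
  by rewrite -{1}(card_ord r) -sum1_card; apply: leq_sum => i _; exact: l_pos.
have nn2 : (2 <= nn)%N by exact: leq_trans r_nn.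
have nmin_le i : (n_min l <= l i)%N.
  rewrite /n_min; move: (\sum_(i < r) l i)%N => x0.
  have := mem_index_enum i; elim: (index_enum _) => [//|j s IH].
  rewrite in_cons big_cons /= => /orP[/eqP <-|/IH]; first exact: geq_minl.
  exact: leq_trans (geq_minr _ _).
have nmin_pos : (0 < n_min l)%N.
  rewrite /n_min; apply: (big_ind (fun x => (0 < x)%N)) => [|x y x0 y0|i _]; last exact: l_pos.
    exact: leq_trans nn2.
  by rewrite leq_min x0 y0.
have nm0 : 0 < nmin by rewrite ltr0n.
have lnm i : nmin <= (l i)%:R by rewrite ler_nat.
have sizeE i : \sum_(a | cl a == i) 1 = (l i)%:R :> R.
  by rewrite sumr_const; congr (_ *+ _); exact: card_cluster.
have BC i j : B i j = B j i by rewrite -{1}B_sym mxE.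
have p_le i : p <= B i i by exact: bigmin_le.
have q_ge i j : i != j -> B i j <= q.
  move=> ij; rewrite /q /q_plus; case: (ltngtP i j) => h.
  - exact: (@le_bigmax_cond _ _ _ _ (i, j) (fun ij => ij.1 < ij.2)%N (fun ij => B ij.1 ij.2)).
  - rewrite BC.
    exact: (@le_bigmax_cond _ _ _ _ (j, i) (fun ij => ij.1 < ij.2)%N (fun ij => B ij.1 ij.2)).
  - by move: ij; rewrite (val_inj h) eqxx.
have q_0 : 0 <= q by exact: bigmax_ge_id.
have deltaE : delta = p - q by [].
have p1 : p <= 1.
  have i0 : 'I_r by exact: (Ordinal (leq_trans (isT : (0 < 2)%N) r2)).
  by apply: le_trans (p_le i0) _; case/andP: (B01 i0 i0).
have ln_ge : 1 / 2 <= ln n.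
  apply: le_trans (ln2_ge_half R) _; rewrite ler_ln ?posrE ?ltr0n ?ler_nat //.
  exact: leq_trans nn2.
have n0 : 0 <= n by exact: ler0n.
have m0 : (0 : R) <= m%:R by exact: ler0n.
have rho1 : (1 : R) <= Num.sqrt r%:R.
  by rewrite -{1}(@sqrtr1 R) ler_wsqrtr // ler1n (leq_trans _ r2).
have [J [nJ LJ]] := log_scale R nn2.
have L0 : 0 <= (2 ^ J.+1)%:R :> R by exact: ler0n.
have row_big i j : 128 * (2 ^ J.+1)%:R <= (if i == j then B j j - lambda else delta) * (l j)%:R / 64 /\
    128 ^+ 2 * (B i j * (l j)%:R) * (2 ^ J.+1)%:R <=
    ((if i == j then B j j - lambda else delta) * (l j)%:R / 64) ^+ 2.
  case: eqVneq => [->|ij].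
    exact: (diag_threshold nm0 ln_ge n0 m0 rho1 al_ge p_ge d_gt (p_le j)).
  apply: (off_threshold nm0 ln_ge n0 m0 rho1 al_ge p_ge d_gt) => //; last exact: ltW.
    by case/andP: (B01 i j).
  by apply: le_trans (q_ge _ _ ij) _; lra.
have diag_big i : 128 * (2 ^ J.+1)%:R <= (B i i - lambda) * (l i)%:R / 64 /\
    128 ^+ 2 * (B i i * (l i)%:R) * (2 ^ J.+1)%:R <= ((B i i - lambda) * (l i)%:R / 64) ^+ 2.
  by have := row_big i i; rewrite eqxx.
have off_big : 128 * (2 ^ J.+1)%:R <= delta * nmin / 64 /\
    128 ^+ 2 * (nn%:R * q) * (2 ^ J.+1)%:R <= (delta * nmin / 64) ^+ 2.
  by apply: (total_threshold nm0 ln_ge q_0 n0 m0 rho1 al_ge p_ge d_gt) => //; exact: ltW.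
pose srow i j : R := (if i == j then B j j - lambda else delta) * (l j)%:R / 64.
pose good := good_config cl (fun i j => B i j) J srow
  (fun i => (B i i - lambda) * (l i)%:R / 64) (delta * nmin / 64).
pose event := [set w | forall X, sdp_solution alpha lambda (A w) X -> recovery_form P X].
(* Goodness concerns [K] alone and the estimates hold for all [Z] and [W], so these may depend on
   [K] arbitrarily. *)
have good_event : [set w | good (edge_config (K w))] `<=` event.
  move=> w /= gw X; rewrite AE => solX.
  have [s PE] : exists s, P = perm_mx s by case/is_perm_mxP: P_perm => s ->; exists s.
  have X_conj : X = P *m relabel s^-1 X *m P^T by rewrite PE -[LHS](relabelKV s).
  rewrite PE in solX; have sol := relabel_solution solX.
  rewrite X_conj; apply: recovery_form_of_inliers; first by case: sol => -[[]].
  have lam0 : 0 <= lambda by lra.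
  have bud := signal_budget nm0 ln_ge n0 m0 rho1 al_ge p_ge d_gt.
  have m_nm : m%:R <= nmin.
    by apply: (signal_outliers nm0 ln_ge n0 m0 rho1 al_ge p_ge d_gt); lra.
  have NE := edge_config_noise cl (K_adj w) BC.
  apply: (@sdp_optimum_inliers R nn r m cl (K w) (Z w) (W w) (fun i j => B i j)
    alpha lambda p delta nmin) => //.
  - by move=> i j; case/andP: (B01 i j).
  - by move=> i; have := p_le i; lra.
  - by move=> i j /q_ge; lra.
  - by rewrite lam0 /=; lra.
  - by lra.
  - by move=> i; rewrite /clsize sizeE.
  - move=> a j; rewrite /clsize sizeE; have := good_config_row a j gw.
    by congr (`|_| <= _); apply: eq_bigr => b _; exact: NE.
  - move=> i v; rewrite /clsize sizeE; have := good_config_diag diag_big i v gw.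
    by congr (_ <= _); apply: eq_bigr => a _; apply: eq_bigr => b _; rewrite -NE.
  - move=> v; have := good_config_off off_big v gw.
    by congr (_ <= _); apply: eq_bigr => a _; apply: eq_bigr => b _; rewrite -NE.
have event_meas : measurable event.
  pose M w := block_mx (K w) (Z w) (Z w)^T (W w).
  pose Phi M' := forall X, sdp_solution alpha lambda (P *m M' *m P^T) X -> recovery_form P X.
  have -> : event = [set w | Phi (M w)].
    by apply/seteqP; split => w; rewrite /event /Phi /= AE.
  apply: (measurable_zero_one_event Phi).
    move=> i j; case: (split_ordP i) => a ->; case: (split_ordP j) => b ->; rewrite /M.
    - by under eq_fun do rewrite block_mxEul; exact: K_rand.
    - by under eq_fun do rewrite block_mxEur; exact: Z_rand.
    - by under eq_fun do rewrite block_mxEdl mxE; exact: Z_rand.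
    - by under eq_fun do rewrite block_mxEdr; exact: W_rand.
  move=> w i j; case: (split_ordP i) => a ->; case: (split_ordP j) => b ->; rewrite /M.
  - by rewrite block_mxEul; case: (K_adj w).
  - by rewrite block_mxEur; exact: Z01.
  - by rewrite block_mxEdl mxE; exact: Z01.
  - by rewrite block_mxEdr; case: (W_adj w).
have good_meas : measurable [set w | good (edge_config (K w))].
  apply: (measurable_zero_one_event (fun M => good (edge_config M))) => // w.
  by case: (K_adj w).
apply: (@le_trans _ _ (Pr [set w | good (edge_config (K w))])); last first.
  by apply: le_measure; rewrite ?inE.
rewrite (edge_config_event K_rand K_adj K_ind K_ber) lee_fin.
pose pe : 'I_nn * 'I_nn -> R := edge_prob (fun a b => B (cl a) (cl b)).
(* The total weight 1 turns the bound for bad configurations into one for good ones. *)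
have tot := bern_expect1 (pe).
rewrite /bern_expect (bigID good) /= in tot.
have bad := bad_config_weight B01 BC sizeE q_0 q_ge row_big diag_big off_big.
have bad1 := le_trans bad (bad_weight_le R nn2 r_nn nJ).
have pos1 : 0 <= 2 * r%:R / n ^+ 2.
  by rewrite divr_ge0 ?mulr_ge0 ?ler0n // exprn_ge0.
have pos2 : 0 <= 1 * r%:R / nmin ^+ 4.
  by rewrite mul1r divr_ge0 ?ler0n // exprn_ge0 // ltW.
have totE : \sum_(k | good k) bern_weight (pe) k +
  \sum_(k | ~~ good k) bern_weight (pe) k = 1.
  by rewrite -[RHS]tot; congr (_ + _); apply: eq_bigr => k _; rewrite mulr1.
move: bad1; rewrite -/good; lra.
Qed.
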